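(* Let either $0<c<2$ and $R_{N,M}$ be the radius function of the discrete map $Z^c$, or $c=0$ and $R_{N,M}$ be the radius function of the discrete logarithm $\mathrm{Log}$ (all as defined in the context). Then there is a constant $K(c)$, independent of $N_0$, such that for every fixed integer $N_0$, $$R_{N_0,M}\simeq K(c)\,M^{c-1}\qquad\text{as } M\to\infty,$$ where $\simeq$ means the ratio of the two sides tends to $1$.
   Context: Let $\mathbb{Z}^2_+=\{(n,m)\in\mathbb{Z}^2:n,m\ge 0\}$. A map $f:\mathbb{Z}^2_+\to\mathbb{C}$ is a discrete conformal map if every elementary quadrilateral has cross-ratio $-1$: $$\frac{(f_{n,m}-f_{n+1,m})(f_{n+1,m+1}-f_{n,m+1})}{(f_{n+1,m}-f_{n+1,m+1})(f_{n,m+1}-f_{n,m})}=-1 .$$ Consider also the constraint, for all $(n,m)\in\mathbb{Z}^2_+$, $$c\, f_{n,m}=2n\frac{(f_{n+1,m}-f_{n,m})(f_{n,m}-f_{n-1,m})}{f_{n+1,m}-f_{n-1,m}}+2m\frac{(f_{n,m+1}-f_{n,m})(f_{n,m}-f_{n,m-1})}{f_{n,m+1}-f_{n,m-1}}\qquad(\ast)$$ (terms with coefficient $0$ omitted). For $0<c<2$, the discrete map $Z^c$ is the discrete conformal map satisfying $(\ast)$ with initial conditions $f_{0,0}=0$, $f_{1,0}=1$, $f_{0,1}=e^{c\pi i/2}$. The discrete map $Z^2$ is the discrete conformal map satisfying $(\ast)$ with $c=2$ (both equations understood after multiplying by their denominators) and initial conditions $f_{0,0}=f_{1,0}=f_{0,1}=0$,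 $f_{2,0}=1$, $f_{0,2}=-1$, $f_{1,1}=2i/\pi$. (The constraint determines $f_{n,0}$, $f_{0,m}$, and the cross-ratio equation then determines all $f_{n,m}$.) For such maps, when $n+m$ is even the four points $f_{n\pm1,m},f_{n,m\pm1}$ are equidistant from $f_{n,m}$. With $N=(n-m)/2$, $M=(n+m)/2$ (so pairs $(n,m)\in\mathbb{Z}^2_+$ with $n+m$ even correspond to integer pairs $(N,M)$ with $M\ge|N|$), the radius function of the map is $R_{N,M}=|f_{n+1,m}-f_{n,m}|$. The discrete logarithm $\mathrm{Log}$ is the discrete conformal map dual to $Z^2$; its radius function is $R^{\mathrm{Log}}_{N,M}=1/R^{Z^2}_{N,M}$, where $R^{Z^2}$ is the radius function of $Z^2$. *)

(* Defs.v *)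
From Stdlib Require Import Reals ZArith.
From Coquelicot Require Import Coquelicot.
Open Scope R_scope.

(* Numerator and denominator of the cross-ratio of the quadrilateral at (n,m):
   cr = ((f_{n,m}-f_{n+1,m})(f_{n+1,m+1}-f_{n,m+1}))
        / ((f_{n+1,m}-f_{n+1,m+1})(f_{n,m+1}-f_{n,m})). *)
Definition cr_num (f : nat -> nat -> C) (n m : nat) : C :=
  ((f n m - f (S n) m) * (f (S n) (S m) - f n (S m)))%C.
Definition cr_den (f : nat -> nat -> C) (n m : nat) : C :=
  ((f (S n) m - f (S n) (S m)) * (f n (S m) - f n m))%C.

Definition discrete_conformal (f : nat -> nat -> C) : Prop :=
  forall n m, cr_den f n m <> 0%C /\ cr_num f n m = (- cr_den f n m)%C.

Definition discrete_conformal_mult (f : nat -> nat -> C) : Prop :=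
  forall n m, cr_num f n m = (- cr_den f n m)%C.

(* The constraint (star): pieces of the term in direction n (resp. m).
   When the coefficient n (resp. m) is 0 the term is omitted: numerator 0,
   denominator 1.  Otherwise
   term = 2n (f_{n+1,m}-f_{n,m})(f_{n,m}-f_{n-1,m}) / (f_{n+1,m}-f_{n-1,m}). *)
Definition cn_num (f : nat -> nat -> C) (n m : nat) : C :=
  match n with
  | O => 0%C
  | S k => (RtoC (2 * INR n) * ((f (S n) m - f n m) * (f n m - f k m)))%C
  end.
Definition cn_den (f : nat -> nat -> C) (n m : nat) : C :=
  match n with
  | O => 1%C
  | S k => (f (S n) m - f k m)%C
  end.
Definition cm_num (f : nat -> nat -> C) (n m : nat) : C :=
  match m with
  | O => 0%C
  | S k => (RtoC (2 * INR m) * ((f n (S m) - f n m) * (f n m - f n k)))%C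
  end.
Definition cm_den (f : nat -> nat -> C) (n m : nat) : C :=
  match m with
  | O => 1%C
  | S k => (f n (S m) - f n k)%C
  end.

Definition constraint_mult (c : R) (f : nat -> nat -> C) : Prop :=
  forall n m,
    (RtoC c * f n m * cn_den f n m * cm_den f n m)%C =
    (cn_num f n m * cm_den f n m + cm_num f n m * cn_den f n m)%C.

Definition constraint (c : R) (f : nat -> nat -> C) : Prop :=
  forall n m, cn_den f n m <> 0%C /\ cm_den f n m <> 0%C /\
    (RtoC c * f n m)%C =
    (cn_num f n m / cn_den f n m + cm_num f n m / cm_den f n m)%C.

Definition is_Zc (c : R) (f : nat -> nat -> C) : Prop :=
  discrete_conformal f /\ constraint c f /\
  f 0%nat 0%nat = 0%C /\ f 1%nat 0%nat = 1%C /\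
  f 0%nat 1%nat = (cos (c * PI / 2), sin (c * PI / 2)).

Definition is_Z2 (f : nat -> nat -> C) : Prop :=
  discrete_conformal_mult f /\ constraint_mult 2 f /\
  f 0%nat 0%nat = 0%C /\ f 1%nat 0%nat = 0%C /\ f 0%nat 1%nat = 0%C /\
  f 2%nat 0%nat = 1%C /\ f 0%nat 2%nat = (-1)%C /\
  f 1%nat 1%nat = (0, 2 / PI).

(* Radius function: R_{N,M} = |f_{n+1,m} - f_{n,m}| with n = M+N, m = M-N
   (meaningful for M >= |N|). *)
Definition radius (f : nat -> nat -> C) (N : Z) (M : nat) : R :=
  let n := Z.to_nat (Z.of_nat M + N) in
  let m := Z.to_nat (Z.of_nat M - N) in
  Cmod (f (S n) m - f n m)%C.

(* Radius function of Log, the dual of Z^2 with radius function f. *)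
Definition radius_Log (f : nat -> nat -> C) (N : Z) (M : nat) : R :=
  / radius f N M.

(* Main.v *)
(* White vertices are those with [n + m] even; they are the centres of an orthogonal circle pattern with radii
   [g n m] whose intersection points are the other, black vertices.

   On the diagonal, write [g (M+1) (M+1) = g M M * tan (PI/4 + phi_M)]. The cross-ratio equation and the
   constraint become the discrete Painleve II equation
     (2M+1) sin 2 phi_M - cos 2 phi_M ((M+1) tan ((phi_M + phi_(M+1))/2) + M tan ((phi_M + phi_(M-1))/2)) = c - 1,
   whose left side is continuous in [phi_M] and decreasing in its neighbours. Perron's method gives a solution
   with all [|phi_M| <= PI/4], hence positive radii on the diagonal. The radii on the parallels to the diagonal are
   then obtained one after the other by a rational formula that visibly preserves positivity.

   Along the boundary the radii [A_N = g (2N) 0] and [B_N = g (2N+1) 1] satisfy [B_N B_(N+1) = A_(N+1)^2], and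
   positivity of the next row forces [B_(N+1) / B_N -> 1]. The moments of [cos (ct/2)] against powers of [cos t]
   solve the same recursion with the same limit, which identifies [B_0 / A_1] (hence [B_0 / A_0 = tan (c PI/4)] if
   [c < 2]). So this positive pattern has the initial data of the given map, and by uniqueness it is that map.

   A bounded solution of the Painleve equation is rigid: its linearisation at 0 contracts by the factor 1/3, so
   [phi_M = (c-1)/(2M+1) + O(1/M^2)], and the diagonal radii are [K M^(c-1) (1 + o(1))]. Neighbouring parallels to the
   diagonal have asymptotically equal radii. *)
Require Import Defs.
From Stdlib Require Import Reals ZArith Lra Lia Psatz Classical.
From Coquelicot Require Import Coquelicot.
Open Scope R_scope.

(** * Algebra of the radius equations *)

(** Nothing is known in advance about the radii of the given map, while the asymptotics need angles
    that stay in [[-PI/4, PI/4]] for all [M]. Forward iteration of the Painleve equation from a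
    prescribed [phi 0] gives no such control, so a global solution is produced first, with no hold
    on [phi 0], and its starting angle is computed afterwards. The boundary is the place for this:
    there the [A_N] obey an explicit first-order linear recursion, and the relation
    [B_N B_(N+1) = A_(N+1)^2] leaves one unknown factor that alternates between a number and its
    inverse. Only the limit 1 of the ratios, a consequence of positivity of the whole pattern,
    forces this factor to be 1.

    The value [c = 2] is carried along everywhere, so that Log needs no analysis of its own: its
    radii are reciprocals of those of Z^2. The price is that the radius at the origin is then 0:
    bounds at the corner are weak, the pattern is normalised away from the origin, and the first
    quadrilateral degenerates. *)

(* Agafonov's linear-fractional relation between the radii at the left, lower, right and upper white neighbours of the
   black vertex [(n, m)]. *)
Definition black_eq (c n m L D R U : R) : Prop :=
  (n - m + 1 - c) * (D * R) + (n + m + 1 - c) * (R * U)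
  = (n + m - 1 + c) * (L * D) + (n - m - 1 + c) * (U * L).

(* At the white vertex [(n, m)] of radius [r], with radii [U] at [(n+1, m+1)], [D] at [(n-1, m-1)] and [p] at
   [(n+1, m-1)]. The version for the radius [l] at [(n-1, m+1)] is obtained by exchanging [n] and [m]. *)
Definition white_eq (n m r U D p : R) : Prop :=
  n * (r * r - p * D) * (U + p) + m * (r * r - U * p) * (p + D) = 0.

(** [white_eq] is affine in [U], and the expression here is the coefficient of [U]. It is negative
    for one of two reasons: either [r * r <= p * D], or the terms free of [U] are positive and have
    to be cancelled. Its sign allows the equation to be solved for [U]. *)
Lemma white_eq_den (n m r U D p : R) :
  0 < n -> 0 < m -> 0 < r -> 0 < U -> 0 <= D -> 0 < p ->
  white_eq n m r U D p -> n * (r * r - p * D) - m * p * (p + D) < 0.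
Proof.
  intros hn hm hr hU hD hp h. unfold white_eq in h.
  assert (0 < m * p * (p + D)) by (apply Rmult_lt_0_compat; nra).
  destruct (Rle_lt_dec (r * r - p * D) 0) as [hX|hX]; [nra|].
  assert (e : U * (n * (r * r - p * D) - m * p * (p + D))
     = - (n * (r * r - p * D) * p + m * (r * r) * (p + D))) by lra.
  assert (0 < n * (r * r - p * D) * p) by (repeat apply Rmult_lt_0_compat; lra).
  assert (0 < m * (r * r) * (p + D)) by (repeat apply Rmult_lt_0_compat; lra).
  nra.
Qed.

(** The side conditions left by [field] are nested expressions; each is recognised as a product [t]
    of factors already known to be nonzero. *)
Ltac neq_as t :=
  match goal with |- ?e <> 0 => replace e with t;
    [ repeat apply Rmult_integral_contrapositive_currified; first [assumption | lra] | ] end.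

(** Compatibility of the constraint with the cross-ratio equation, for one step from the white
    vertex [(n, m)] to [(n + 1, m - 1)]. Solving the three equations for [U], [D] and [U1] leaves a
    rational identity in the free radii [r], [p], [D1]; signs serve to keep the denominators
    nonzero. *)
Lemma white_eq_shift (c n m r U D p D1 U1 : R) :
  0 < c <= 2 -> 1 < m -> m <= n ->
  0 < r -> 0 < U -> 0 < D -> 0 < p -> 0 < D1 -> 0 < U1 ->
  white_eq n m r U D p -> black_eq c n (m - 1) D D1 p r -> black_eq c (n + 1) m r p U1 U ->
  white_eq (m - 1) (n + 1) p U1 D1 r.
Proof.
  intros hc hm hn hr hU hD hp hD1 hU1 h2 hSE hNE.
  assert (hden := white_eq_den n m r U D p ltac:(lra) ltac:(lra) hr hU (Rlt_le _ _ hD) hp h2).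
  assert (eU : U = (n * (r * r - p * D) * p + m * (r * r) * (p + D)) /
            (m * p * (p + D) - n * (r * r - p * D))).
  { unfold white_eq in h2. field_simplify_eq; lra. }
  unfold black_eq in *.
  assert (hk : 0 < (n + m - 2 + c) * D1 + (n - m + c) * r) by nra.
  assert (eD : D = p * ((n - m + 2 - c) * D1 + (n + m - c) * r) /
     ((n + m - 2 + c) * D1 + (n - m + c) * r)).
  { field_simplify_eq; lra. }
  assert (hk1 : 0 < (n - m + 2 - c) * p + (n + m + 2 - c) * U) by nra.
  assert (eU1 : U1 = r * ((n + m + c) * p + (n - m + c) * U) /
     ((n - m + 2 - c) * p + (n + m + 2 - c) * U)).
  { field_simplify_eq; lra. }
  unfold white_eq. rewrite eU1.
  clear eU1 hU1 hNE hSE h2 U1. subst U. subst D.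
  match type of hden with ?x < 0 => match type of hk1 with 0 < ?y => match type of hk with 0 < ?k =>
  assert (hk0 : k <> 0) by lra;
  assert (hx : x <> 0) by lra; assert (hy : y <> 0) by lra;
  clear -hk0 hx hy;
  field; repeat split;
  [ exact hk0
  | neq_as (x * k * -1); field; exact hk0
  | neq_as (y * (x * k * -1)); field; split; [exact hk0 | neq_as (x * k * -1); field; exact hk0 ] ]
  end end end.
Qed.

(** The case [m = 1]: on the axis the black equation and the new constraint both lose a factor
    [D1 + r], so no radius below the axis occurs. [D] may be 0, as it is at the origin for
    [c = 2]. *)
Lemma white_eq_shift0 (c n r U D p U1 : R) :
  0 < c <= 2 -> 1 <= n ->
  0 < r -> 0 < U -> 0 <= D -> 0 < p -> 0 < U1 ->
  white_eq n 1 r U D p -> (n + 1 - c) * p = (n - 1 + c) * D -> black_eq c (n + 1) 1 r p U1 U ->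
  p * p = U1 * r.
Proof.
  intros hc hn hr hU hD hp hU1 h2 hSE hNE.
  assert (hden := white_eq_den n 1 r U D p ltac:(lra) ltac:(lra) hr hU hD hp h2).
  assert (eU : U = (n * (r * r - p * D) * p + 1 * (r * r) * (p + D)) /
            (1 * p * (p + D) - n * (r * r - p * D))).
  { unfold white_eq in h2. field_simplify_eq; lra. }
  unfold black_eq in *.
  assert (hk : 0 < n - 1 + c) by lra.
  assert (eD : D = p * (n + 1 - c) / (n - 1 + c)).
  { field_simplify_eq; lra. }
  assert (hk1 : 0 < (n - 1 + 2 - c) * p + (n + 1 + 2 - c) * U) by nra.
  assert (eU1 : U1 = r * ((n + 1 + c) * p + (n - 1 + c) * U) /
     ((n - 1 + 2 - c) * p + (n + 1 + 2 - c) * U)).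
  { field_simplify_eq; lra. }
  rewrite eU1.
  clear eU1 hU1 hNE hSE h2 U1. subst U. subst D.
  match type of hden with ?x < 0 => match type of hk1 with 0 < ?y => match type of hk with 0 < ?k =>
  assert (hk0 : k <> 0) by lra;
  assert (hx : x <> 0) by lra; assert (hy : y <> 0) by lra;
  clear -hk0 hx hy;
  field; repeat split;
  [ exact hk0
  | neq_as (x * k * -1); field; exact hk0
  | neq_as (y * (x * k * -1)); field; split; [exact hk0 | neq_as (x * k * -1); field; exact hk0 ] ]
  end end end.
Qed.

(** The cross-ratio equation passes to the next column when the new radii [p], [p1] are obtained
    from [l], [l1] by the reflection formula. Eliminating [UU], [D] and [U] leaves an identity in
    [r], [l], [l1]. *)
Lemma black_eq_shift (c n m r U D l l1 UU p p1 : R) :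
  0 < c <= 2 -> 0 < m -> m + 2 <= n ->
  0 < r -> 0 < U -> 0 < D -> 0 < l -> 0 < l1 -> 0 < UU ->
  white_eq m n r U D l -> white_eq (m + 1) (n + 1) U UU r l1 -> black_eq c n (m + 1) l r U l1 ->
  p = l * (n * U + m * D) / (n * D + m * U) ->
  p1 = l1 * ((n + 1) * UU + (m + 1) * r) / ((n + 1) * r + (m + 1) * UU) ->
  black_eq c (n + 1) m r p p1 U.
Proof.
  intros hc hm hn hr hU hD hl hl1 hUU h2 h2' hNW ep ep1.
  assert (hden' := white_eq_den (m+1) (n+1) U UU r l1 ltac:(lra) ltac:(lra) hU hUU (Rlt_le _ _ hr) hl1 h2').
  assert (eUU : UU = ((m + 1) * (U * U - l1 * r) * l1 + (n + 1) * (U * U) * (l1 + r)) /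
            ((n + 1) * l1 * (l1 + r) - (m + 1) * (U * U - l1 * r))).
  { unfold white_eq in h2'. field_simplify_eq; lra. }
  (* [white_eq] is unchanged when [n], [m] and [U], [D] are exchanged together, so the same lemma
     serves to solve for [D]. *)
  assert (h2s : white_eq n m r D U l) by (unfold white_eq in *; lra).
  assert (hden := white_eq_den n m r D U l ltac:(lra) ltac:(lra) hr hD (Rlt_le _ _ hU) hl h2s).
  assert (eD : D = (n * (r * r - l * U) * l + m * (r * r) * (l + U)) /
            (m * l * (l + U) - n * (r * r - l * U))).
  { unfold white_eq in h2s. field_simplify_eq; lra. }
  unfold black_eq in *.
  assert (hk : 0 < (n - m - c) * r + (n + m + 2 - c) * l1).
  { assert (0 <= n - m - c) by lra. assert (0 < n + m + 2 - c) by lra. nra. }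
  assert (eU : U = l * ((n + m + c) * r + (n - m - 2 + c) * l1) /
     ((n - m - c) * r + (n + m + 2 - c) * l1)).
  { field_simplify_eq; lra. }
  assert (hp : 0 < n * D + m * U) by nra.
  assert (hp1 : 0 < (n + 1) * r + (m + 1) * UU) by nra.
  subst p p1. clear h2 h2s h2' hNW hUU. rewrite eUU in hp1 |- *. clear eUU.
  clear hD. rewrite eD in hp |- *. clear eD D. subst U.
  match type of hden with ?x < 0 => match type of hk with 0 < ?k => match type of hp with 0 < ?y => match type of hp1 with 0 < ?y1 => match type of hden' with ?x1 < 0 =>
  assert (hk0 : k <> 0) by lra;
  assert (hx : x <> 0) by lra; assert (hy : y <> 0) by lra;
  assert (hx1 : x1 <> 0) by lra; assert (hy1 : y1 <> 0) by lra
  ;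
  clear -hk0 hx hx1 hy hy1; field; repeat split;
  [ exact hk0
  | neq_as (x * k * -1); field; exact hk0
  | neq_as (y * (x * k * -1) * k); field; split; [exact hk0 | neq_as (x * k * -1); field; exact hk0 ]
  | neq_as (x1 * (k * k) * -1); field; exact hk0
  | neq_as (y1 * (x1 * (k * k) * -1)); field; split; [exact hk0 | neq_as (x1 * (k * k) * -1); field; exact hk0 ] ]
  end end end end end.
Qed.
Lemma black_eq_shift0 (c n r U l l1 UU p1 : R) :
  0 < c <= 2 -> 2 <= n ->
  0 < r -> 0 < U -> 0 < l -> 0 < l1 -> 0 < UU ->
  r * r = U * l -> white_eq 1 (n + 1) U UU r l1 -> black_eq c n 1 l r U l1 ->
  p1 = l1 * ((n + 1) * UU + 1 * r) / ((n + 1) * r + 1 * UU) ->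
  (n + 2 - c) * p1 = (n + c) * r.
Proof.
  intros hc hn hr hU hl hl1 hUU h2 h2' hNW ep1.
  assert (hden' := white_eq_den 1 (n+1) U UU r l1 ltac:(lra) ltac:(lra) hU hUU (Rlt_le _ _ hr) hl1 h2').
  assert (eUU : UU = ((U * U - l1 * r) * l1 + (n + 1) * (U * U) * (l1 + r)) /
            ((n + 1) * l1 * (l1 + r) - (U * U - l1 * r))).
  { unfold white_eq in h2'. field_simplify_eq; lra. }
  unfold black_eq in *.
  assert (hk : 0 < (n - c) * r + (n + 2 - c) * l1) by nra.
  (* [U] enters only through its square; multiplying the black equation by [U] and using
     [r * r = U * l] makes that square rational in [r] and [l1]. *)
  assert (eQ : U * U = r * r * ((n + c) * r + (n - 2 + c) * l1) /
     ((n - c) * r + (n + 2 - c) * l1)).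
  { assert (e : U * (((n - c) * r + (n + 2 - c) * l1) * U) = U * (l * ((n + c) * r + (n - 2 + c) * l1)))
      by (f_equal; lra).
    replace (U * (l * ((n + c) * r + (n - 2 + c) * l1)))
      with (r * r * ((n + c) * r + (n - 2 + c) * l1)) in e by (rewrite h2; ring).
    rewrite <- e. field. lra. }
  assert (hp1 : 0 < (n + 1) * r + 1 * UU) by nra.
  subst p1. clear h2 h2' hNW hUU. rewrite eUU in hp1 |- *. clear eUU.
  replace (1 * (U * U - l1 * r) - (n + 1) * l1 * (l1 + r))
    with (-1 * ((n + 1) * l1 * (l1 + r) - (U * U - l1 * r))) in hden' by ring.
  rewrite eQ in *. clear eQ.
  match type of hden' with -1 * ?x < 0 => match type of hk with 0 < ?k => match type of hp1 with 0 < ?y =>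
  assert (hk0 : k <> 0) by lra;
  assert (hx : x <> 0) by lra; assert (hy : y <> 0) by lra;
  clear -hk0 hx hy; field; repeat split;
  [ exact hk0
  | neq_as (x * k); field; exact hk0
  | neq_as (y * (x * k)); field; split; [exact hk0 | neq_as (x * k); field; exact hk0 ] ]
  end end end.
Qed.
Lemma white_eq_reflect (n m r U D l p : R) :
  0 < n * D + m * U -> p = l * (n * U + m * D) / (n * D + m * U) ->
  white_eq m n r U D l -> white_eq n m r U D p.
Proof.
  intros h ep hw. subst p. unfold white_eq in *.
  match goal with |- ?x = 0 =>
    replace x with ((n * U + m * D) / (n * D + m * U) *
      (m * (r * r - l * D) * (U + l) + n * (r * r - U * l) * (l + D))) by (field; lra) end.
  rewrite hw. ring.
Qed.

(** Schramm's equation for orthogonal circles: [r * r] times the first elementary symmetric function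
    of the neighbours equals the third. For positive radii the four angles [atan (x / r)] then add
    up to [PI], so the kites around the white vertex close up. *)
Definition schramm_eq (r p U l D : R) : Prop :=
  r * r * (p + U + l + D) = p * l * (U + D) + U * D * (p + l).

Lemma white_eq_schramm (n m r U D l p : R) :
  0 < n -> 0 <= m -> 0 < n * D + m * U -> p = l * (n * U + m * D) / (n * D + m * U) ->
  white_eq m n r U D l -> schramm_eq r p U l D.
Proof.
  intros hn hm h ep hw. subst p. unfold schramm_eq. unfold white_eq in hw.
  apply Rminus_diag_uniq.
  match goal with |- ?x = 0 =>
    replace x with ((U + D) / (n * D + m * U) *
      (m * (r * r - l * D) * (U + l) + n * (r * r - U * l) * (l + D))) by (field; lra) end.
  rewrite hw. ring.
Qed.

(* Entry [k] of column [N] is the radius at the white vertex [(2N + k, k)], i.e. [R_{N, N + k}]; [s] is the diagonal and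
   [q k] the radius at [(k + 1, k - 1)]. *)
Fixpoint columns (s q : nat -> R) (N : nat) : (nat -> R) * (nat -> R) :=
  match N with
  | O => (s, fun k => q (S k))
  | S N' =>
      let (l, r) := columns s q N' in
      (r, fun k =>
        let n := 2 * INR N' + INR k + 3 in
        let m := INR k + 1 in
        l (S (S k)) * (n * r (S (S k)) + m * r k) / (n * r k + m * r (S (S k))))
  end.

Definition column (s q : nat -> R) (N : nat) : nat -> R := fst (columns s q N).

(** The invariant carried from column to column. The clause on the entries 0 is the black equation
    at [(2N + 1, 0)] without its common factor; [l 0] is only nonnegative because the radius at the
    origin vanishes for [c = 2]. *)
Definition adjacent_columns (c : R) (N : nat) (l r : nat -> R) : Prop :=
  0 <= l 0%nat /\ (forall k, 0 < l (S k)) /\ (forall k, 0 < r k) /\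
  (2 * INR N + 2 - c) * r 0%nat = (2 * INR N + c) * l 0%nat /\
  (forall k, black_eq c (2 * INR N + INR k + 2) (INR k + 1) (l (S k)) (r k) (r (S k)) (l (S (S k)))) /\
  (forall k, white_eq (2 * INR N + INR k + 1) (INR k + 1) (l (S k)) (l (S (S k))) (l k) (r k)).

Definition diagonal (c : R) (s q : nat -> R) : Prop :=
  adjacent_columns c 0 s (fun k => q (S k)).

Lemma column_SS (s q : nat -> R) (N k : nat) :
  let n := 2 * INR N + INR k + 3 in
  let m := INR k + 1 in
  let r := column s q (S N) in
  column s q (S (S N)) k
  = column s q N (S (S k)) * (n * r (S (S k)) + m * r k) / (n * r k + m * r (S (S k))).
Proof.
  unfold column. simpl. destruct (columns s q N); simpl. reflexivity.
Qed.

(** In [adjacent_columns] the constraint looks from [l] to the right. Here the constraint at the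
    vertices of [r] is expressed through their left neighbours, which is where the reflection
    defining the next column starts. *)
Lemma column_reflection (c : R) (N : nat) (l r : nat -> R) :
  0 < c <= 2 -> adjacent_columns c N l r ->
  r 0%nat * r 0%nat = r 1%nat * l 1%nat /\
  forall k, white_eq (INR k + 1) (2 * INR N + INR k + 3) (r (S k)) (r (S (S k))) (r k) (l (S (S k))).
Proof.
  intros hc (hl0 & hl & hr & hb0 & hb & hw). assert (hN := pos_INR N). split.
  - specialize (hb 0%nat); specialize (hw 0%nat). simpl INR in *.
    apply (white_eq_shift0 c (2 * INR N + 1) (l 1%nat) (l 2%nat) (l 0%nat)); auto; try lra.
    + unfold white_eq, black_eq in *; lra.
    + unfold white_eq, black_eq in *; lra.
  - intros k. assert (hk := pos_INR k).
    pose proof (hb k) as hb1. pose proof (hb (S k)) as hb2. pose proof (hw (S k)) as hw1.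
    rewrite S_INR in hb2, hw1.
    pose proof (white_eq_shift c (2 * INR N + INR k + 2) (INR k + 2)
      (l (S (S k))) (l (S (S (S k)))) (l (S k)) (r (S k)) (r k) (r (S (S k)))) as h.
    replace (INR k + 2 - 1) with (INR k + 1) in h by ring.
    replace (2 * INR N + INR k + 2 + 1) with (2 * INR N + INR k + 3) in h by ring.
    apply h; auto; try lra.
    + unfold white_eq, black_eq in *; lra.
    + unfold white_eq, black_eq in *; lra.
Qed.

Lemma column_step (c : R) (N : nat) (l r p : nat -> R) :
  0 < c <= 2 -> adjacent_columns c N l r ->
  (forall k, let n := 2 * INR N + INR k + 3 in let m := INR k + 1 in
     p k = l (S (S k)) * (n * r (S (S k)) + m * r k) / (n * r k + m * r (S (S k)))) ->
  adjacent_columns c (S N) r p.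
Proof.
  intros hc hlr hp. assert (hN := pos_INR N).
  destruct (column_reflection c N l r hc hlr) as [h0 h1].
  destruct hlr as (hl0 & hl & hr & hb0 & hb & hw).
  unfold adjacent_columns. rewrite S_INR.
  repeat split.
  - apply Rlt_le, hr.
  - intros k; apply hr.
  - intros k. rewrite hp. assert (hk := pos_INR k). assert (hr0 := hr k). assert (hr2 := hr (S (S k))).
    apply Rdiv_lt_0_compat; [apply Rmult_lt_0_compat; [apply hl | nra] | nra].
  - pose proof (black_eq_shift0 c (2 * INR N + 2) (r 0%nat) (r 1%nat) (l 1%nat) (l 2%nat) (r 2%nat) (p 0%nat)) as h.
    replace (2 * (INR N + 1) + 2 - c) with (2 * INR N + 2 + 2 - c) by ring.
    replace (2 * (INR N + 1) + c) with (2 * INR N + 2 + c) by ring.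
    specialize (h1 0%nat); specialize (hp 0%nat); specialize (hb 0%nat). simpl INR in *.
    apply h; auto; try lra.
    + unfold white_eq, black_eq in *; lra.
    + unfold white_eq, black_eq in *; lra.
    + rewrite hp. unfold Rdiv. f_equal; [ring | f_equal; ring].
  - intros k. assert (hk := pos_INR k).
    pose proof (hb (S k)) as hb2. pose proof (h1 (S k)) as h2. pose proof (hp (S k)) as hp2.
    rewrite S_INR in hb2, h2, hp2.
    pose proof (black_eq_shift c (2 * INR N + INR k + 3) (INR k + 1)
      (r (S k)) (r (S (S k))) (r k) (l (S (S k))) (l (S (S (S k)))) (r (S (S (S k)))) (p k) (p (S k))) as h.
    replace (2 * (INR N + 1) + INR k + 2) with (2 * INR N + INR k + 3 + 1) by ring.
    apply h; auto; try lra.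
    + unfold white_eq, black_eq in *; lra.
    + unfold white_eq, black_eq in *; lra.
    + cbv zeta in hp2. rewrite hp2. unfold Rdiv. f_equal; [ring | f_equal; ring].
  - intros k. assert (hk := pos_INR k).
    apply (white_eq_reflect _ _ _ _ _ (l (S (S k)))).
    + assert (hr0 := hr k). assert (hr2 := hr (S (S k))). nra.
    + rewrite hp. unfold Rdiv. f_equal; [ring | f_equal; ring].
    + replace (2 * (INR N + 1) + INR k + 1) with (2 * INR N + INR k + 3) by ring. apply h1.
Qed.

Lemma column_adjacent (c : R) (s q : nat -> R) (N : nat) :
  0 < c <= 2 -> diagonal c s q -> adjacent_columns c N (column s q N) (column s q (S N)).
Proof.
  intros hc h. induction N as [|N IH].
  - exact h.
  - apply (column_step c N (column s q N)); auto. intros k n m. apply column_SS.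
Qed.
(** * The diagonal *)

Definition dP (M x y z : R) : R :=
  (2 * M + 1) * sin (2 * x) - cos (2 * x) * ((M + 1) * tan ((x + y) / 2) + M * tan ((x + z) / 2)).

Lemma tan_le (x y : R) : - (PI / 2) < x -> x <= y -> y < PI / 2 -> tan x <= tan y.
Proof.
  intros h1 [h|h] h2; [apply Rlt_le, tan_increasing; lra | subst; lra].
Qed.

Lemma dP_antitone (M x y y' z z' : R) :
  0 <= M -> - (PI / 4) <= x <= PI / 4 ->
  - (PI / 4) <= y -> y <= y' -> y' <= PI / 4 ->
  - (PI / 4) <= z -> z <= z' -> z' <= PI / 4 ->
  dP M x y' z' <= dP M x y z.
Proof.
  intros hM hx h1 h2 h3 h4 h5 h6. unfold dP. assert (hpi := PI_RGT_0).
  assert (hc : 0 <= cos (2 * x)) by (apply cos_ge_0; lra).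
  assert (tan ((x + y) / 2) <= tan ((x + y') / 2)) by (apply tan_le; lra).
  assert (tan ((x + z) / 2) <= tan ((x + z') / 2)) by (apply tan_le; lra).
  apply Rplus_le_compat_l, Ropp_le_contravar, Rmult_le_compat_l; [exact hc|].
  apply Rplus_le_compat; apply Rmult_le_compat_l; lra.
Qed.

Lemma dP_continuous (M x y z : R) :
  - (PI / 4) <= x <= PI / 4 -> - (PI / 4) <= y <= PI / 4 -> - (PI / 4) <= z <= PI / 4 ->
  continuous (fun t => dP M t y z) x.
Proof.
  intros hx hy hz. assert (hpi := PI_RGT_0).
  apply @ex_derive_continuous. unfold dP, tan. auto_derive.
  repeat split; apply Rgt_not_eq, cos_gt_0; lra.
Qed.

Lemma continuous_lt_near (g : R -> R) (x a : R) :
  continuous g x -> g x < a ->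
  exists d : posreal, forall t, Rabs (t - x) < d -> g t < a.
Proof.
  intros hg hx. apply (hg (fun v => v < a)). apply open_lt, hx.
Qed.

(** [pred 0] is 0, but there the coefficient [M] of this neighbour vanishes: the corner equation has
    a single neighbour. *)
Definition subsolution (c : R) (phi : nat -> R) : Prop :=
  (forall M, - (PI / 4) <= phi M <= PI / 4) /\
  (forall M, dP (INR M) (phi M) (phi (S M)) (phi (pred M)) <= c - 1).

Lemma dP_top (M y z : R) : dP M (PI / 4) y z = 2 * M + 1.
Proof.
  unfold dP. replace (2 * (PI / 4)) with (PI / 2) by field. rewrite sin_PI2, cos_PI2. ring.
Qed.

Lemma dP_bot (M y z : R) : dP M (- (PI / 4)) y z = - (2 * M + 1).
Proof.
  unfold dP. replace (2 * - (PI / 4)) with (- (PI / 2)) by field.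
  rewrite sin_neg, cos_neg, sin_PI2, cos_PI2. ring.
Qed.

(** Monotonicity in the neighbours makes the pointwise supremum of subsolutions a subsolution. Where
    its inequality is strict, continuity leaves room to raise one value, and this only lowers [dP]
    at the neighbours. The ends are barriers: [dP] is [-(2M+1)] at [-PI/4] and [2M+1] at [PI/4], and
    [c - 1] lies between the two. *)
Lemma dP_solution_exists (c : R) :
  0 < c <= 2 ->
  exists phi : nat -> R, (forall M, - (PI / 4) <= phi M <= PI / 4) /\
    (forall M, dP (INR M) (phi M) (phi (S M)) (phi (pred M)) = c - 1).
Proof.
  intros hc. assert (hpi := PI_RGT_0).
  pose (E := fun M v => exists phi, subsolution c phi /\ phi M = v).
  assert (hE : subsolution c (fun _ => - (PI / 4))).
  { split; [intros; lra|]. intros M. rewrite dP_bot. assert (h := pos_INR M). lra. }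
  assert (hlub : forall M, { s | is_lub (E M) s }).
  { intros M. apply completeness.
    - exists (PI / 4). intros v (phi & [h _] & <-). apply h.
    - exists (- (PI / 4)), (fun _ => - (PI / 4)). auto. }
  pose (phi := fun M => proj1_sig (hlub M)).
  assert (hphi : forall M, is_lub (E M) (phi M)) by (intros M; exact (proj2_sig (hlub M))).
  clearbody phi. clear hlub.
  assert (hup : forall psi, subsolution c psi -> forall M, psi M <= phi M).
  { intros psi h M. apply (hphi M). exists psi. auto. }
  assert (hb : forall M, - (PI / 4) <= phi M <= PI / 4).
  { intros M. split; [apply (hup _ hE)|].
    apply (hphi M). intros v (psi & [h _] & <-). apply h. }
  assert (hle : forall M, dP (INR M) (phi M) (phi (S M)) (phi (pred M)) <= c - 1).
  { intros M. apply Rnot_lt_le. intros hlt.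
    destruct (continuous_lt_near (fun t => - dP (INR M) t (phi (S M)) (phi (pred M))) (phi M) (- (c - 1)))
      as [d hd]; [|lra|].
    { apply (continuous_opp (V := R_NormedModule)), dP_continuous; auto. }
    destruct (classic (exists v, E M v /\ phi M - d < v)) as [(v & (psi & hpsi & <-) & hv)|hn].
    - specialize (hd (psi M)). assert (h1 := hup psi hpsi).
      (* [psi M] is so close to the supremum that [dP] still exceeds [c - 1] there; the smaller
         neighbours of [psi] only increase it, which contradicts [subsolution]. *)
      assert (- dP (INR M) (psi M) (phi (S M)) (phi (pred M)) < - (c - 1)).
      { apply hd. rewrite Rabs_left1; [lra|]. specialize (h1 M). lra. }
      destruct hpsi as [hb' hs'].
      assert (dP (INR M) (psi M) (phi (S M)) (phi (pred M)) <= dP (INR M) (psi M) (psi (S M)) (psi (pred M))).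
      { apply dP_antitone; auto; try apply hb; try apply hb'. apply pos_INR. }
      specialize (hs' M). lra.
    - assert (phi M <= phi M - d); [|destruct d; simpl in *; lra].
      apply (hphi M). intros v hv. apply Rnot_lt_le. intros h. apply hn. exists v. auto. }
  exists phi. split; [exact hb|]. intros M. apply Rle_antisym; [apply hle|].
  apply Rnot_lt_le. intros hlt.
  assert (htop : phi M < PI / 4).
  { destruct (hb M) as [_ [h|h]]; [exact h|]. rewrite h, dP_top in hlt.
    assert (h' := pos_INR M). lra. }
  destruct (continuous_lt_near (fun t => dP (INR M) t (phi (S M)) (phi (pred M))) (phi M) (c - 1))
    as [d hd]; [apply dP_continuous; auto | exact hlt |].
  pose (x := Rmin (PI / 4) (phi M + d / 2)).
  assert (hx : phi M < x <= PI / 4 /\ x < phi M + d).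
  { unfold x. destruct d as [d hd0]; simpl. unfold Rmin. destruct Rle_dec; lra. }
  pose (psi := fun j => if Nat.eqb j M then x else phi j).
  assert (hge : forall j, phi j <= psi j).
  { intros j. unfold psi. destruct (Nat.eqb_spec j M); [subst|]; lra. }
  assert (hpb : forall j, - (PI / 4) <= psi j <= PI / 4).
  { intros j. specialize (hb j). unfold psi. destruct (Nat.eqb_spec j M); [subst|]; lra. }
  assert (hpsi : subsolution c psi).
  { split; [exact hpb|]. intros j. destruct (Nat.eq_dec j M) as [->|hj].
    - assert (- (PI / 4) <= x <= PI / 4) by (specialize (hb M); lra).
      replace (psi M) with x by (unfold psi; now rewrite Nat.eqb_refl).
      apply Rle_trans with (dP (INR M) x (phi (S M)) (phi (pred M))).
      + apply dP_antitone; auto; try apply pos_INR; try apply hb; try apply hpb.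
      + apply Rlt_le, hd. rewrite Rabs_pos_eq; lra.
    - replace (psi j) with (phi j) by (unfold psi; now rewrite (proj2 (Nat.eqb_neq j M) hj)).
      apply Rle_trans with (dP (INR j) (phi j) (phi (S j)) (phi (pred j))); [|apply hle].
      apply dP_antitone; auto; try apply hb; try apply hpb. apply pos_INR. }
  assert (h := hup psi hpsi M). unfold psi in h. rewrite Nat.eqb_refl in h. lra.
Qed.

(** * Radii on the diagonal and next to it *)

(** Normalised to 1 at [(1, 1)] and extended backwards to the origin, because the radius at the
    origin is 0 when [c = 2]. *)
Fixpoint diag_radius (phi : nat -> R) (k : nat) : R :=
  match k with
  | O => tan (PI / 4 - phi 0%nat)
  | S k' => match k' with O => 1 | S _ => diag_radius phi k' * tan (PI / 4 + phi k') end
  end.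

(** By symmetry both side neighbours of [(k, k)] have this radius, and the angles [atan (x / r)] at
    that vertex must add up to [PI]: these are [PI/4 + phi k], [PI/4 - phi (k-1)] and twice the
    unknown one. *)
Definition side_radius (phi : nat -> R) (k : nat) : R :=
  diag_radius phi k * tan (PI / 4 + (phi (pred k) - phi k) / 2).

Lemma tan_pos (x : R) : 0 < x < PI / 2 -> 0 < tan x.
Proof. intros h. apply tan_gt_0; lra. Qed.

Lemma cos_pos (x : R) : - (PI / 2) < x < PI / 2 -> 0 < cos x.
Proof. intros h. apply cos_gt_0; lra. Qed.

Lemma tan_PI2_minus (x : R) : tan (PI / 2 - x) = cos x / sin x.
Proof. unfold tan. now rewrite sin_shift, cos_shift. Qed.

Lemma dP_trig (M a y z : R) :
  let S := sin (PI / 4 + a) in let C := cos (PI / 4 + a) in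
  dP M a y z = (2 * M + 1) * (S * S - C * C)
    - 2 * S * C * ((M + 1) * tan ((a + y) / 2) + M * tan ((a + z) / 2)).
Proof.
  intros S C. unfold dP.
  replace (sin (2 * a)) with (S * S - C * C).
  2:{ unfold S, C. replace (2 * a) with (2 * (PI / 4 + a) - PI / 2) by field.
      rewrite sin_minus, sin_PI2, cos_PI2, cos_2a. ring. }
  replace (cos (2 * a)) with (2 * S * C).
  2:{ unfold S, C. replace (2 * a) with (2 * (PI / 4 + a) - PI / 2) by field.
      rewrite cos_minus, sin_PI2, cos_PI2, sin_2a. ring. }
  reflexivity.
Qed.

(** [PI/4 + (a - y)/2] is the difference of [PI/4 + a] and [(a + y)/2], so this tangent becomes
    rational in the quantities that occur in [dP]. *)
Lemma tan_out (a y : R) :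
  - (PI / 4) <= a <= PI / 4 -> - (PI / 4) <= y <= PI / 4 -> - (PI / 2) < PI / 4 + (a - y) / 2 < PI / 2 ->
  let S := sin (PI / 4 + a) in let C := cos (PI / 4 + a) in let X := tan ((a + y) / 2) in
  C + S * X <> 0 /\ tan (PI / 4 + (a - y) / 2) = (S - C * X) / (C + S * X).
Proof.
  intros ha hy h S C X. assert (hpi := PI_RGT_0).
  assert (hs : 0 < cos ((a + y) / 2)) by (apply cos_pos; lra).
  assert (hb := cos_pos _ h).
  replace (PI / 4 + (a - y) / 2) with ((PI / 4 + a) - (a + y) / 2) in * by field.
  unfold tan at 1. rewrite sin_minus. rewrite cos_minus in *. fold S C in hb |- *.
  assert (e : C + S * X = (C * cos ((a + y) / 2) + S * sin ((a + y) / 2)) / cos ((a + y) / 2)).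
  { unfold X, tan. field. lra. }
  assert (C + S * X <> 0).
  { rewrite e. apply Rgt_not_eq, Rdiv_lt_0_compat; lra. }
  split; [assumption|]. rewrite e. unfold X, tan. field. lra.
Qed.

Lemma tan_in (a z : R) :
  - (PI / 4) <= a <= PI / 4 -> - (PI / 4) <= z <= PI / 4 -> - (PI / 2) < PI / 4 + (z - a) / 2 < PI / 2 ->
  let S := sin (PI / 4 + a) in let C := cos (PI / 4 + a) in let X := tan ((a + z) / 2) in
  S - C * X <> 0 /\ tan (PI / 4 + (z - a) / 2) = (C + S * X) / (S - C * X).
Proof.
  intros ha hz h S C X. assert (hpi := PI_RGT_0).
  assert (hs : 0 < cos ((a + z) / 2)) by (apply cos_pos; lra).
  assert (hb := cos_pos _ h).
  replace (PI / 4 + (z - a) / 2) with (PI / 2 - ((PI / 4 + a) - (a + z) / 2)) in * by field.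
  unfold tan at 1. rewrite sin_shift. rewrite cos_shift in *. rewrite cos_minus. rewrite sin_minus in *.
  fold S C in hb |- *.
  assert (e : S - C * X = (S * cos ((a + z) / 2) - C * sin ((a + z) / 2)) / cos ((a + z) / 2)).
  { unfold X, tan. field. lra. }
  assert (S - C * X <> 0).
  { rewrite e. apply Rgt_not_eq, Rdiv_lt_0_compat; lra. }
  split; [assumption|]. rewrite e. unfold X, tan. field. lra.
Qed.

Lemma dP_black_eq (c M s a y z : R) :
  - (PI / 4) < a < PI / 4 -> - (PI / 4) < y < PI / 4 -> - (PI / 4) <= z <= PI / 4 ->
  dP M a y z = c - 1 ->
  let s' := s * tan (PI / 4 + a) in
  black_eq c (M + 1) M s (s * tan (PI / 4 + (z - a) / 2)) (s' * tan (PI / 4 + (a - y) / 2)) s'.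
Proof.
  intros ha hy hz h s'. assert (hpi := PI_RGT_0). unfold s'. clear s'.
  rewrite dP_trig in h.
  destruct (tan_out a y) as [h1 ->]; try lra.
  destruct (tan_in a z) as [h2 ->]; try lra.
  assert (hC : 0 < cos (PI / 4 + a)) by (apply cos_pos; lra).
  assert (h1' := sin2_cos2 (PI / 4 + a)). unfold Rsqr in h1'.
  set (S := sin (PI / 4 + a)) in *. set (C := cos (PI / 4 + a)) in *.
  set (Y := tan ((a + y) / 2)) in *. set (Z := tan ((a + z) / 2)) in *.
  change (tan (PI / 4 + a)) with (S / C).
  unfold black_eq. apply Rminus_diag_uniq.
  (* Writing 1 as [S * S + C * C] makes the identity homogeneous, so that [field] can treat [S] and
     [C] as independent. *)
  set (w := S * S + C * C).
  match goal with |- ?x = 0 => replace x with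
    (s * s * w * (2 * (M + 1) * (S - C * Y) * S - 2 * M * (C + S * Z) * C - c * w)
      / (C * C * (S - C * Z) * (C + S * Y))) by (unfold w; field; lra) end.
  replace (2 * (M + 1) * (S - C * Y) * S - 2 * M * (C + S * Z) * C - c * w) with 0.
  - unfold Rdiv. ring.
  - replace w with 1 by (unfold w; lra). lra.
Qed.

(** At the corner [a = PI / 4] has to be allowed, for [c = 2]. There [C] is 0, so the division is by
    [S] instead, and the radius at the origin enters as [tan (PI / 4 - a)]. *)
Lemma dP_black_eq0 (c a y z : R) :
  - (PI / 4) < a <= PI / 4 -> - (PI / 4) < y < PI / 4 -> dP 0 a y z = c - 1 ->
  (2 - c) * tan (PI / 4 + (a - y) / 2) = c * tan (PI / 4 - a).
Proof.
  intros ha hy h. assert (hpi := PI_RGT_0).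
  rewrite dP_trig in h.
  destruct (tan_out a y) as [h1 ->]; try lra.
  assert (hS : 0 < sin (PI / 4 + a)) by (apply sin_gt_0; lra).
  assert (h1' := sin2_cos2 (PI / 4 + a)). unfold Rsqr in h1'.
  replace (PI / 4 - a) with (PI / 2 - (PI / 4 + a)) by field.
  rewrite tan_PI2_minus.
  set (S := sin (PI / 4 + a)) in *. set (C := cos (PI / 4 + a)) in *.
  set (Y := tan ((a + y) / 2)) in *.
  apply Rminus_diag_uniq.
  set (w := S * S + C * C).
  match goal with |- ?x = 0 => replace x with
    ((2 * S * (S - C * Y) - c * w) / (S * (C + S * Y))) by (unfold w; field; lra) end.
  replace (2 * S * (S - C * Y) - c * w) with 0.
  - unfold Rdiv. ring.
  - replace w with 1 by (unfold w; lra). lra.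
Qed.

(** For [n = m] and equal side neighbours the constraint is, up to the factor [M], Schramm's
    equation, which here says [al + be + be + ga = PI]. *)
Lemma diag_white_eq (M s a z : R) :
  - (PI / 4) < a < PI / 4 -> - (PI / 4) < z <= PI / 4 ->
  white_eq M M s (s * tan (PI / 4 + a)) (s * tan (PI / 4 - z)) (s * tan (PI / 4 + (z - a) / 2)).
Proof.
  intros ha hz. assert (hpi := PI_RGT_0).
  set (al := PI / 4 + a). set (ga := PI / 4 - z).
  replace (PI / 4 + (z - a) / 2) with ((PI - al - ga) / 2) by (unfold al, ga; field).
  set (be := (PI - al - ga) / 2).
  assert (h : sin ((al + be) + (be + ga)) = 0).
  { replace ((al + be) + (be + ga)) with PI by (unfold be; field). apply sin_PI. }
  rewrite sin_plus, !sin_plus, !cos_plus in h.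
  assert (h1 : 0 < cos al) by (apply cos_pos; unfold al; lra).
  assert (h2 : 0 < cos be) by (apply cos_pos; unfold be, al, ga; lra).
  assert (h3 : 0 < cos ga) by (apply cos_pos; unfold ga; lra).
  unfold white_eq, tan.
  match type of h with ?x = 0 => match goal with |- ?y = 0 =>
    replace y with (M * s * s * s * x / (cos al * cos be * cos be * cos ga)) by (field; lra) end end.
  rewrite h. unfold Rdiv. ring.
Qed.

(** At an endpoint of the range the equation reads [-(2k+1) = c - 1] or [2k+1 = c - 1]. For
    [0 < c <= 2] only the second can hold, with [k = 0] and [c = 2]; hence the weak upper bound,
    strict beyond 0. *)
Record diag_solution (c : R) (phi : nat -> R) : Prop := {
  sol_range : forall k, - (PI / 4) < phi k <= PI / 4;
  sol_range_S : forall k, phi (S k) < PI / 4;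
  sol_eq : forall k, dP (INR k) (phi k) (phi (S k)) (phi (pred k)) = c - 1 }.

Lemma diag_solution_exists (c : R) :
  0 < c <= 2 -> exists phi, diag_solution c phi.
Proof.
  intros hc. destruct (dP_solution_exists c hc) as (phi & hb & he). exists phi. split.
  - intros k. destruct (hb k) as [[h|h] h']; [lra|].
    specialize (he k). rewrite <- h, dP_bot in he. assert (hk := pos_INR k). lra.
  - intros k. destruct (hb (S k)) as [_ [h|h]]; [exact h|].
    specialize (he (S k)). rewrite h, dP_top, S_INR in he. assert (hk := pos_INR k). lra.
  - exact he.
Qed.

Lemma diag_radius_1 (phi : nat -> R) : diag_radius phi 1 = 1.
Proof. reflexivity. Qed.

Lemma diag_radius_SS (phi : nat -> R) (k : nat) :
  diag_radius phi (S (S k)) = diag_radius phi (S k) * tan (PI / 4 + phi (S k)).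
Proof. reflexivity. Qed.

Lemma diag_radius_pred (c : R) (phi : nat -> R) (k : nat) :
  diag_solution c phi -> diag_radius phi k = diag_radius phi (S k) * tan (PI / 4 - phi k).
Proof.
  intros [h1 h2 _]. assert (hpi := PI_RGT_0). destruct k as [|k].
  - rewrite diag_radius_1. simpl. ring.
  - rewrite diag_radius_SS. specialize (h1 (S k)); specialize (h2 k).
    replace (PI / 4 - phi (S k)) with (PI / 2 - (PI / 4 + phi (S k))) by field.
    assert (0 < sin (PI / 4 + phi (S k))) by (apply sin_gt_0; lra).
    assert (0 < cos (PI / 4 + phi (S k))) by (apply cos_pos; lra).
    rewrite tan_PI2_minus. unfold tan. field. lra.
Qed.

Lemma diag_radius_pos (c : R) (phi : nat -> R) (k : nat) :
  diag_solution c phi -> 0 < diag_radius phi (S k).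
Proof.
  intros [h1 h2 _]. assert (hpi := PI_RGT_0). induction k as [|k IH].
  - rewrite diag_radius_1. lra.
  - rewrite diag_radius_SS. specialize (h1 (S k)); specialize (h2 k).
    apply Rmult_lt_0_compat; [exact IH | apply tan_pos; lra].
Qed.

Lemma side_radius_pos (c : R) (phi : nat -> R) (k : nat) :
  diag_solution c phi -> 0 < side_radius phi (S k).
Proof.
  intros h. assert (h0 := diag_radius_pos c phi k h). destruct h as [h1 h2 _]. assert (hpi := PI_RGT_0).
  unfold side_radius. simpl pred. specialize (h2 k) as h2'. specialize (h1 (S k)) as h1'. specialize (h1 k).
  apply Rmult_lt_0_compat; [exact h0 | apply tan_pos; lra].
Qed.

Lemma diag_solution_diagonal (c : R) (phi : nat -> R) :
  diag_solution c phi -> diagonal c (diag_radius phi) (side_radius phi).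
Proof.
  intros h. assert (hpi := PI_RGT_0). unfold diagonal, adjacent_columns. simpl INR.
  repeat split.
  - rewrite (diag_radius_pred c) by exact h. rewrite diag_radius_1.
    destruct h as [h _ _]. destruct (h 0%nat) as [h1 [h2|h2]].
    + assert (0 < tan (PI / 4 - phi 0%nat)) by (apply tan_pos; lra). lra.
    + rewrite h2. replace (PI / 4 - PI / 4) with 0 by ring. rewrite tan_0. lra.
  - intros k. apply (diag_radius_pos c), h.
  - intros k. apply (side_radius_pos c), h.
  - rewrite Rmult_0_r, !Rplus_0_l. unfold side_radius. simpl. rewrite Rmult_1_l.
    destruct h as [h1 h2 h3]. apply (dP_black_eq0 c _ _ (phi 0%nat)); [apply h1 | | apply (h3 0%nat)].
    specialize (h1 1%nat). specialize (h2 0%nat). lra.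
  - intros k. unfold side_radius. rewrite diag_radius_SS.
    destruct h as [h1 h2 h3].
    pose proof (dP_black_eq c (INR (S k)) (diag_radius phi (S k)) (phi (S k)) (phi (S (S k))) (phi k)) as hb.
    rewrite S_INR in hb. replace (2 * 0 + INR k + 2) with (INR k + 1 + 1) by ring.
    apply hb; clear hb.
    + specialize (h1 (S k)). specialize (h2 k). lra.
    + specialize (h1 (S (S k))). specialize (h2 (S k)). lra.
    + specialize (h1 k). lra.
    + rewrite <- S_INR. apply (h3 (S k)).
  - intros k. replace (2 * 0 + INR k + 1) with (INR k + 1) by ring. unfold side_radius.
    rewrite (diag_radius_pred c phi k h), diag_radius_SS. simpl pred.
    destruct h as [h1 h2 h3]. apply diag_white_eq.
    + specialize (h1 (S k)). specialize (h2 k). lra.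
    + apply h1.
Qed.
(** * The boundary *)

(** Used with [e = c / 2]: Cauchy's integral, whose value is a quotient of Gamma values. In integral
    form positivity and monotonicity in [n] are evident, and they take the place of the asymptotics
    of Gamma. *)
Definition cos_moment (e : R) (n : nat) : R :=
  RInt (fun t => cos (e * t) * cos t ^ n) 0 (PI / 2).

Lemma cos_moment_continuous (e : R) (n : nat) (t : R) :
  continuous (fun t => cos (e * t) * cos t ^ n) t.
Proof. apply @ex_derive_continuous. auto_derive. exact I. Qed.

Lemma cos_moment_ex (e : R) (n : nat) (a b : R) :
  ex_RInt (fun t => cos (e * t) * cos t ^ n) a b.
Proof. apply @ex_RInt_continuous. intros. apply cos_moment_continuous. Qed.

Lemma cos_moment_pos (e : R) (n : nat) : 0 < e <= 1 -> 0 < cos_moment e n.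
Proof.
  intros he. assert (hpi := PI_RGT_0). apply RInt_gt_0; [lra| |].
  - intros t ht. apply Rmult_lt_0_compat; [|apply pow_lt]; apply cos_pos; nra.
  - intros t ht. apply cos_moment_continuous.
Qed.

Lemma cos_moment_decr (e : R) (n : nat) : 0 < e <= 1 -> cos_moment e (S n) <= cos_moment e n.
Proof.
  intros he. assert (hpi := PI_RGT_0). apply RInt_le; [lra|apply cos_moment_ex|apply cos_moment_ex|].
  intros t ht. assert (0 < cos (e * t)) by (apply cos_pos; nra).
  assert (0 < cos t) by (apply cos_pos; lra). assert (0 < cos t ^ n) by (apply pow_lt; lra).
  assert (h := COS_bound t). simpl. apply Rmult_le_compat_l; nra.
Qed.

Lemma cos_moment_rec (e : R) (n : nat) :
  ((INR n + 2) ^ 2 - e ^ 2) * cos_moment e (S (S n)) = (INR n + 2) * (INR n + 1) * cos_moment e n.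
Proof.
  (* A primitive found by integrating by parts twice; its boundary values vanish since
     [cos (PI/2) = 0] and [sin 0 = 0]. *)
  pose (G := fun t => (INR n + 2) * (cos (e * t) * cos t ^ S n * sin t) - e * (sin (e * t) * cos t ^ S (S n))).
  pose (g := fun t => ((INR n + 2) ^ 2 - e ^ 2) * (cos (e * t) * cos t ^ S (S n))
     - (INR n + 2) * (INR n + 1) * (cos (e * t) * cos t ^ n)).
  assert (h : is_RInt g 0 (PI / 2) (minus (G (PI / 2)) (G 0))).
  { apply (is_RInt_derive G g).
    - intros t _. unfold G, g. auto_derive; [exact I|].
      assert (hs : sin t * sin t = 1 - cos t * cos t).
      { assert (h := sin2_cos2 t). unfold Rsqr in h. lra. }
      match goal with |- ?l = ?r => apply Rminus_diag_uniq; replace (l - r) with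
        ((INR n + 2) * (INR n + 1) * cos (e * t) * cos t ^ n * ((1 - cos t * cos t) - sin t * sin t)) end.
      + rewrite hs. ring.
      + simpl pow. destruct n; simpl INR; simpl pow; ring.
    - intros t _. unfold g. apply @ex_derive_continuous. auto_derive. exact I. }
  assert (h' : is_RInt g 0 (PI / 2) (minus (scal ((INR n + 2) ^ 2 - e ^ 2) (cos_moment e (S (S n))))
      (scal ((INR n + 2) * (INR n + 1)) (cos_moment e n)))).
  { apply @is_RInt_minus; apply @is_RInt_scal; apply (RInt_correct (V := R_CompleteNormedModule)), cos_moment_ex. }
  apply (is_RInt_unique (V := R_CompleteNormedModule)) in h. apply (is_RInt_unique (V := R_CompleteNormedModule)) in h'. rewrite h in h'.
  unfold G in h'. replace (e * 0) with 0 in h' by ring. rewrite cos_PI2, sin_0 in h'.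
  unfold minus, plus, opp, scal in h'. simpl in h'. unfold mult in h'. simpl in h'. lra.
Qed.

Lemma cos_moment_0 (e : R) : 0 < e -> e * cos_moment e 0 = sin (e * (PI / 2)).
Proof.
  intros he.
  assert (h : is_RInt (fun t => cos (e * t) * cos t ^ 0) 0 (PI / 2)
     (minus (sin (e * (PI / 2)) / e) (sin (e * 0) / e))).
  { apply (is_RInt_derive (fun t => sin (e * t) / e)).
    - intros t _. auto_derive; [exact I|]. simpl. field. lra.
    - intros t _. apply cos_moment_continuous. }
  apply (is_RInt_unique (V := R_CompleteNormedModule)) in h. unfold cos_moment. rewrite h.
  rewrite Rmult_0_r, sin_0. unfold minus, plus, opp. simpl. field. lra.
Qed.

(** The primitive behind [cos_moment_rec] with [n = -1], where the boundary term at [PI/2]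
    survives. *)
Lemma cos_moment_1 (e : R) : (1 - e ^ 2) * cos_moment e 1 = cos (e * (PI / 2)).
Proof.
  assert (h : is_RInt (fun t => scal (1 - e ^ 2) (cos (e * t) * cos t ^ 1)) 0 (PI / 2)
     (minus (cos (e * (PI / 2)) * sin (PI / 2) - e * (sin (e * (PI / 2)) * cos (PI / 2)))
       (cos (e * 0) * sin 0 - e * (sin (e * 0) * cos 0)))).
  { apply (is_RInt_derive (fun t => cos (e * t) * sin t - e * (sin (e * t) * cos t))).
    - intros t _. auto_derive; [exact I|]. unfold scal; simpl; unfold mult; simpl. ring.
    - intros t _. apply @ex_derive_continuous. unfold scal; simpl; unfold mult; simpl. auto_derive. exact I. }
  assert (h' : is_RInt (fun t => scal (1 - e ^ 2) (cos (e * t) * cos t ^ 1)) 0 (PI / 2)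
     (scal (1 - e ^ 2) (cos_moment e 1))).
  { apply @is_RInt_scal; apply (RInt_correct (V := R_CompleteNormedModule)), cos_moment_ex. }
  apply (is_RInt_unique (V := R_CompleteNormedModule)) in h. apply (is_RInt_unique (V := R_CompleteNormedModule)) in h'. rewrite h in h'.
  replace (e * 0) with 0 in h' by ring. rewrite cos_PI2, sin_PI2, sin_0 in h'.
  unfold minus, plus, opp, scal in h'. simpl in h'. unfold mult in h'. simpl in h'. simpl. lra.
Qed.

(** At [e = 1], the case [c = 2], [cos_moment_1] reduces to [0 = 0]. The value found here accounts
    for the [PI] in the initial datum [f 1 1] of Z^2. *)
Lemma cos_moment_1_1 : cos_moment 1 1 = PI / 4.
Proof.
  assert (h : is_RInt (fun t => cos (1 * t) * cos t ^ 1) 0 (PI / 2)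
     (minus ((PI / 2 + sin (PI / 2) * cos (PI / 2)) / 2) ((0 + sin 0 * cos 0) / 2))).
  { apply (is_RInt_derive (fun t => (t + sin t * cos t) / 2)).
    - intros t _. auto_derive; [exact I|]. replace (1 * t) with t by ring.
      assert (h := sin2_cos2 t). unfold Rsqr in h. simpl. nra.
    - intros t _. apply cos_moment_continuous. }
  apply (is_RInt_unique (V := R_CompleteNormedModule)) in h. unfold cos_moment. rewrite h.
  rewrite cos_PI2, sin_0. unfold minus, plus, opp. simpl. field.
Qed.

(** * Limits of ratios and growth along the boundary *)

Lemma is_lim_seq_inv_INR : is_lim_seq (fun n => / INR n) 0.
Proof.
  apply (is_lim_seq_inv INR p_infty is_lim_seq_INR). discriminate.
Qed.

Lemma is_lim_seq_div1 (u v : nat -> R) :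
  is_lim_seq u 1 -> is_lim_seq v 1 -> is_lim_seq (fun n => u n / v n) 1.
Proof.
  intros hu hv. replace 1 with (1 / 1) by field.
  apply is_lim_seq_div'; [exact hu | exact hv | lra].
Qed.

Lemma is_lim_seq_mult1 (u v : nat -> R) :
  is_lim_seq u 1 -> is_lim_seq v 1 -> is_lim_seq (fun n => u n * v n) 1.
Proof.
  intros hu hv. replace 1 with (1 * 1) by ring. now apply is_lim_seq_mult'.
Qed.

Lemma is_lim_seq_inv1 (u : nat -> R) :
  is_lim_seq u 1 -> is_lim_seq (fun n => / u n) 1.
Proof.
  intros hu. apply (is_lim_seq_ext (fun n => 1 / u n)); [intros n; unfold Rdiv; ring|].
  apply is_lim_seq_div1; [apply is_lim_seq_const | exact hu].
Qed.

Lemma is_lim_seq_linear_ratio (a b d : R) :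
  a <> 0 -> is_lim_seq (fun n => (a * INR n + b) / (a * INR n + d)) 1.
Proof.
  intros ha.
  assert (h : forall x, is_lim_seq (fun n => 1 + x * / INR n) 1).
  { intros x. replace (Finite 1) with (Finite (1 + x * 0)) by (f_equal; ring).
    apply is_lim_seq_plus'; [apply is_lim_seq_const|].
    apply (is_lim_seq_scal_l (fun n => / INR n) x 0), is_lim_seq_inv_INR. }
  apply (is_lim_seq_ext_loc (fun n => (1 + (b / a) * / INR n) / (1 + (d / a) * / INR n))).
  - assert (h1 : Rbar_locally 1 (fun x => 0 < x)) by (apply (open_gt 0); simpl; lra).
    destruct (h (d / a) _ h1) as [N hN]. exists (S N). intros n hn.
    specialize (hN n ltac:(lia)). assert (0 < INR n) by (apply lt_0_INR; lia).
    replace (a * INR n + d) with (a * INR n * (1 + d / a * / INR n)) by (field; lra).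
    field. split; [lra|]. split; [lra|].
    replace (a * INR n + d) with (a * INR n * (1 + d / a * / INR n)) by (field; lra).
    apply Rmult_integral_contrapositive_currified; [apply Rmult_integral_contrapositive_currified|]; lra.
  - apply is_lim_seq_div1; apply h.
Qed.

Lemma is_lim_seq_squeeze1 (u v : nat -> R) :
  (forall n, 1 <= u n <= v n) -> is_lim_seq v 1 -> is_lim_seq u 1.
Proof.
  intros h hv. apply (is_lim_seq_le_le (fun _ => 1) u v); auto. apply is_lim_seq_const.
Qed.

(** Wallis's argument: by monotonicity the quotient lies between 1 and
    [cos_moment e n / cos_moment e (n + 2)], which the recursion makes explicit. *)
Lemma cos_moment_ratio_lim (e : R) :
  0 < e <= 1 -> is_lim_seq (fun n => cos_moment e n / cos_moment e (S n)) 1.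
Proof.
  intros he.
  apply (is_lim_seq_squeeze1 _ (fun n => (1 * INR n + (2 - e)) / (1 * INR n + 1) * ((1 * INR n + (2 + e)) / (1 * INR n + 2)))).
  - intros n. assert (h0 := cos_moment_pos e n he). assert (h1 := cos_moment_pos e (S n) he).
    assert (h2 := cos_moment_pos e (S (S n)) he).
    assert (d0 := cos_moment_decr e n he). assert (d1 := cos_moment_decr e (S n) he).
    assert (hr := cos_moment_rec e n). assert (hn := pos_INR n). split.
    + apply Rle_div_r; lra.
    + apply Rle_trans with (cos_moment e n / cos_moment e (S (S n))).
      * apply Rmult_le_compat_l; [lra|]. now apply Rinv_le_contravar.
      * apply Req_le. apply (Rmult_eq_reg_r (cos_moment e (S (S n)) * ((INR n + 2) * (INR n + 1)))); [|nra].
        field_simplify; [|lra|lra]. nra.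
  - apply is_lim_seq_mult1; apply is_lim_seq_linear_ratio; lra.
Qed.

(** The relation makes [rho] periodic with period 2, so its values at even indices equal the
    limit. *)
Lemma ratio_alternates_to_one (rho : nat -> R) :
  (forall n, rho (S n) * rho n = 1) -> is_lim_seq rho 1 -> rho 0%nat = 1.
Proof.
  intros h hl.
  assert (h2 : forall k, rho (2 * k)%nat = rho 0%nat).
  { induction k as [|k IH]; [reflexivity|]. replace (2 * S k)%nat with (S (S (2 * k))) by lia.
    rewrite <- IH. assert (h1 := h (2 * k)%nat). assert (h1' := h (S (2 * k))).
    assert (hz : rho (S (2 * k)) <> 0) by (intros hz; rewrite hz in h1; lra).
    apply (Rmult_eq_reg_r (rho (S (2 * k)))); lra. }
  assert (hs : is_lim_seq (fun k => rho (2 * k)%nat) 1).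
  { apply is_lim_seq_subseq; [|exact hl]. intros P [N hN]. exists N. intros n hn. apply hN. lia. }
  apply (is_lim_seq_ext _ (fun _ => rho 0%nat)) in hs; [|exact h2].
  apply is_lim_seq_unique in hs. rewrite Lim_seq_const in hs. now injection hs.
Qed.
(** A black equation of the first interior row has the form [D * x = U * y] with [x], [y] linear in
    two consecutive radii [L], [Q] of that row. As [D] and [U] are positive, [x] and [y] have the
    same sign, which confines [L / Q] between two bounds tending to 1. *)
Lemma first_row_growth (c : R) (s q : nat -> R) :
  0 < c <= 2 -> diagonal c s q ->
  is_lim_seq (fun N => column s q N 1 / column s q (S N) 1) 1.
Proof.
  intros hc hd. apply (is_lim_seq_incr_1 (fun N => column s q N 1 / column s q (S N) 1)).
  apply (is_lim_seq_le_le (fun N => (2 * INR N + (4 - c)) / (2 * INR N + (4 + c))) _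
     (fun N => (2 * INR N + (6 - c)) / (2 * INR N + (2 + c)))).
  2, 3: apply is_lim_seq_linear_ratio; lra.
  intros N.
  destruct (column_adjacent c s q (S N) hc hd) as (_ & hl & hr & _ & hb & _).
  specialize (hb 0%nat). assert (h1 := hl 0%nat). assert (h2 := hl 1%nat).
  assert (h3 := hr 0%nat). assert (h4 := hr 1%nat).
  rewrite S_INR in hb. unfold black_eq in hb. simpl INR in hb. assert (hN := pos_INR N).
  set (L := column s q (S N) 1) in *. set (U := column s q (S N) 2) in *.
  set (D := column s q (S (S N)) 0) in *. set (Q := column s q (S (S N)) 1) in *.
  assert (e : D * ((2 * INR N + 4 - c) * Q - (2 * INR N + 4 + c) * L)
     = U * ((2 * INR N + 2 + c) * L - (2 * INR N + 6 - c) * Q)) by lra.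
  clear hb. assert (hLQ : 0 < L * Q) by (apply Rmult_lt_0_compat; lra). split.
  - apply Rle_div_l; [lra|].
    replace (L / Q * (2 * INR N + (4 + c))) with ((2 * INR N + 4 + c) * L / Q) by (field; lra).
    apply Rle_div_r; [lra|]. apply Rnot_lt_le. intros h.
    assert (0 < D * ((2 * INR N + 4 - c) * Q - (2 * INR N + 4 + c) * L))
      by (apply Rmult_lt_0_compat; lra).
    assert (0 < (2 * INR N + 2 + c) * L - (2 * INR N + 6 - c) * Q) by nra. nra.
  - refine (proj1 (Rle_div_r _ _ (2 * INR N + (2 + c)) _) _); [lra|].
    replace (L / Q * (2 * INR N + (2 + c))) with ((2 * INR N + 2 + c) * L / Q) by (field; lra).
    apply Rle_div_l; [lra|]. apply Rnot_lt_le. intros h.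
    assert (0 < U * ((2 * INR N + 2 + c) * L - (2 * INR N + 6 - c) * Q))
      by (apply Rmult_lt_0_compat; lra).
    assert (0 < (2 * INR N + 4 - c) * Q - (2 * INR N + 4 + c) * L) by nra. nra.
Qed.

(* Both [B_N / A_{N+1}] (boundary radii [A], first interior row [B]) and a multiple of the quotient of successive
   cosine moments solve [y_{N+1} y_N = A_{N+1} / A_{N+2}] and tend to [1], hence they agree. *)
Lemma boundary_value (c : R) (s q : nat -> R) :
  0 < c <= 2 -> diagonal c s q ->
  s 1%nat * ((1 + c / 2) * cos_moment (c / 2) 1) = q 1%nat * cos_moment (c / 2) 0.
Proof.
  intros hc hd. set (e := c / 2). assert (he : 0 < e <= 1) by (unfold e; lra).
  pose (A := fun N => column s q N 0). pose (B := fun N => column s q N 1).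
  assert (hpos : forall N, 0 < A (S N) /\ 0 < B N).
  { intros N. destruct (column_adjacent c s q N hc hd) as (_ & hl & hr & _). split; [apply hr | apply hl]. }
  assert (hA : forall N, (INR N + 1 - e) * A (S N) = (INR N + e) * A N).
  { intros N. destruct (column_adjacent c s q N hc hd) as (_ & _ & _ & h & _). unfold A, e. lra. }
  assert (hB : forall N, A (S N) * A (S N) = B (S N) * B N).
  { intros N. apply (column_reflection c N (column s q N)); [exact hc|]. now apply column_adjacent. }
  (* The second factor turns the product [cos_moment e N / cos_moment e (N + 2)] of two successive
     quotients into [A_{N+1} / A_{N+2}]. *)
  pose (J := fun N => cos_moment e N / cos_moment e (S N) * ((1 * INR N + 1) / (1 * INR N + (1 + e)))).
  pose (y := fun N => B N / A (S N)).
  assert (hI : forall N, 0 < cos_moment e N) by (intros; now apply cos_moment_pos).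
  assert (hJ0 : forall N, 0 < J N).
  { intros N. unfold J. assert (hN := pos_INR N).
    apply Rmult_lt_0_compat; apply Rdiv_lt_0_compat; auto; lra. }
  assert (hy0 : forall N, 0 < y N) by (intros N; apply Rdiv_lt_0_compat; apply hpos).
  assert (hJ : is_lim_seq J 1).
  { apply is_lim_seq_mult1; [now apply cos_moment_ratio_lim | apply is_lim_seq_linear_ratio; lra]. }
  assert (hy : is_lim_seq y 1).
  { apply (is_lim_seq_ext (fun N => sqrt (B N / B (S N)))).
    - intros N. rewrite <- (sqrt_square (y N)) by (apply Rlt_le, hy0). f_equal. unfold y.
      destruct (hpos N), (hpos (S N)).
      replace (B N / A (S N) * (B N / A (S N))) with (B N * B N / (A (S N) * A (S N))) by (field; lra).
      rewrite hB. field. lra.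
    - replace (Finite 1) with (Finite (sqrt 1)) by (now rewrite sqrt_1).
      apply is_lim_seq_continuous; [apply continuity_pt_sqrt; lra|].
      now apply (first_row_growth c). }
  assert (h : y 0%nat / J 0%nat = 1).
  { apply (ratio_alternates_to_one (fun N => y N / J N)); [|now apply is_lim_seq_div1].
    intros N. destruct (hpos N) as [a1 b1], (hpos (S N)) as [a2 b2].
    assert (h1 := hI N). assert (h2 := hI (S N)). assert (h3 := hI (S (S N))). assert (hN := pos_INR N).
    assert (hr := cos_moment_rec e N). assert (hA' := hA (S N)). rewrite S_INR in hA'.
    assert (hA1 : A (S (S N)) = (INR N + 1 + e) / (INR N + 1 + 1 - e) * A (S N)).
    { apply (Rmult_eq_reg_l (INR N + 1 + 1 - e)); [|lra]. rewrite hA'. field. lra. }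
    assert (hI2 : cos_moment e N = ((INR N + 2) ^ 2 - e ^ 2) / ((INR N + 2) * (INR N + 1)) * cos_moment e (S (S N))).
    { apply (Rmult_eq_reg_l ((INR N + 2) * (INR N + 1))); [|nra]. rewrite <- hr. field. lra. }
    assert (hB1 : B (S N) = A (S N) * A (S N) / B N).
    { rewrite hB. field. lra. }
    unfold y, J. rewrite hI2, hB1, hA1, S_INR. field.
    repeat split; try lra. nra. }
  assert (h0 : y 0%nat = J 0%nat).
  { apply (Rmult_eq_reg_r (/ J 0%nat)); [|apply Rinv_neq_0_compat, Rgt_not_eq, hJ0].
    rewrite Rinv_r by (apply Rgt_not_eq, hJ0). exact h. }
  unfold y, J, A, B in h0. simpl in h0. change (column s q 0 1) with (s 1%nat) in h0.
  change (column s q 1 0) with (q 1%nat) in h0.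
  assert (h1 := hI 0%nat). assert (h2 := hI 1%nat). destruct (hpos 0%nat) as [h3 _].
  change (A 1%nat) with (q 1%nat) in h3.
  replace (s 1%nat) with (s 1%nat / q 1%nat * q 1%nat) by (field; lra). rewrite h0. field. lra.
Qed.
(** * Identification of the map with the circle pattern *)

(** The pattern is continued symmetrically across the diagonal. Halving the difference is exact for
    [n + m] even, and only there is the value a radius. *)
Definition grid (s q : nat -> R) (n m : nat) : R :=
  if Nat.leb m n then column s q (Nat.div2 (n - m)) m else column s q (Nat.div2 (m - n)) n.

Lemma grid_column (s q : nat -> R) (N k : nat) :
  grid s q (k + 2 * N) k = column s q N k /\ grid s q k (k + 2 * N) = column s q N k.
Proof.
  unfold grid.
  assert (e : Nat.div2 (k + 2 * N - k) = N) by (replace (k + 2 * N - k)%nat with (2 * N)%nat by lia; apply Nat.div2_double).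
  split.
  - rewrite (proj2 (Nat.leb_le _ _)) by lia. now rewrite e.
  - destruct (Nat.leb_spec (k + 2 * N) k) as [h|h].
    + assert (N = 0%nat) as -> by lia. simpl. now rewrite Nat.add_0_r, Nat.sub_diag.
    + now rewrite e.
Qed.

Lemma white_cases (n m : nat) :
  Nat.even (n + m) = true -> exists N, (n = m + 2 * N \/ m = n + 2 * N)%nat.
Proof.
  intros h. apply Nat.even_spec in h. destruct h as [k hk].
  destruct (Nat.le_ge_cases m n) as [h|h].
  - exists (k - m)%nat. lia.
  - exists (k - n)%nat. lia.
Qed.

Lemma column_pos (c : R) (s q : nat -> R) (N k : nat) :
  0 < c <= 2 -> diagonal c s q -> (N + k <> 0)%nat -> 0 < column s q N k.
Proof.
  intros hc hd h. destruct N as [|N].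
  - destruct k as [|k]; [lia|]. apply hd.
  - apply (column_adjacent c s q N hc hd).
Qed.

Lemma grid_pos (c : R) (s q : nat -> R) (n m : nat) :
  0 < c <= 2 -> diagonal c s q -> Nat.even (n + m) = true -> (n + m <> 0)%nat -> 0 < grid s q n m.
Proof.
  intros hc hd h h0. destruct (white_cases n m h) as [N [-> | ->]];
  [rewrite (proj1 (grid_column s q N m)) | rewrite (proj2 (grid_column s q N n))];
  apply (column_pos c); auto; lia.
Qed.

Lemma grid_00 (s q : nat -> R) : grid s q 0 0 = s 0%nat.
Proof. reflexivity. Qed.

Lemma grid_11 (s q : nat -> R) : grid s q 1 1 = s 1%nat.
Proof. reflexivity. Qed.

(** On the diagonal the left neighbour is the mirror image of the right one, whence the [match]. Off
    the diagonal, given the constraint, the equation restates the reflection formula that defines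
    the next column. *)
Lemma column_schramm (c : R) (s q : nat -> R) (N k : nat) :
  0 < c <= 2 -> diagonal c s q ->
  schramm_eq (column s q N (S k)) (column s q (S N) k) (column s q N (S (S k)))
    (match N with O => column s q 1 k | S N' => column s q N' (S (S k)) end) (column s q N k).
Proof.
  intros hc hd. assert (hk := pos_INR k).
  destruct (column_adjacent c s q N hc hd) as (h0 & h1 & _ & _ & _ & hw).
  assert (hD : 0 <= column s q N k) by (destruct k; [exact h0 | apply Rlt_le, h1]).
  assert (hU := h1 (S k)).
  destruct N as [|N].
  - specialize (hw k). simpl INR in hw. rewrite Rmult_0_r, Rplus_0_l in hw.
    apply (white_eq_schramm (INR k + 1) (INR k + 1)); try lra; try nra.
    + field. nra.
    + exact hw.
  - destruct (column_reflection c N _ _ hc (column_adjacent c s q N hc hd)) as [_ hr].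
    specialize (hr k). assert (hN := pos_INR N).
    apply (white_eq_schramm (2 * INR N + INR k + 3) (INR k + 1)); try lra; try nra.
    + apply column_SS.
    + exact hr.
Qed.

Lemma schramm_eq_sym (r p U l D : R) : schramm_eq r p U l D -> schramm_eq r l U p D.
Proof. unfold schramm_eq. lra. Qed.

Lemma grid_sym (s q : nat -> R) (n m : nat) :
  Nat.even (n + m) = true -> grid s q n m = grid s q m n.
Proof.
  intros h. destruct (white_cases n m h) as [N [-> | ->]].
  - destruct (grid_column s q N m) as [-> ->]. reflexivity.
  - destruct (grid_column s q N n) as [-> ->]. reflexivity.
Qed.

Lemma grid_schramm (c : R) (s q : nat -> R) (n m : nat) :
  0 < c <= 2 -> diagonal c s q -> Nat.even (n + m) = true ->
  schramm_eq (grid s q (S n) (S m)) (grid s q (S (S n)) m) (grid s q (S (S n)) (S (S m)))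
    (grid s q n (S (S m))) (grid s q n m).
Proof.
  intros hc hd.
  assert (hc1 := fun N k => proj1 (grid_column s q N k)).
  assert (hc2 := fun N k => proj2 (grid_column s q N k)).
  assert (hright : forall N m, let n := (m + 2 * N)%nat in
    schramm_eq (grid s q (S n) (S m)) (grid s q (S (S n)) m) (grid s q (S (S n)) (S (S m)))
      (grid s q n (S (S m))) (grid s q n m)).
  { clear n m. intros N m n. subst n. pose proof (column_schramm c s q N m hc hd) as hs.
    change (S (m + 2 * N)) with (S m + 2 * N)%nat. change (S (S m + 2 * N)) with (S (S m) + 2 * N)%nat at 2.
    replace (S (S m + 2 * N)) with (m + 2 * S N)%nat by lia.
    rewrite !hc1. destruct N as [|N].
    - simpl (m + 2 * 0)%nat. rewrite Nat.add_0_r.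
      replace (grid s q m (S (S m))) with (column s q 1 m); [exact hs|].
      rewrite <- hc2. f_equal. lia.
    - replace (m + 2 * S N)%nat with (S (S m) + 2 * N)%nat by lia. rewrite hc1. exact hs. }
  intros h. destruct (white_cases n m h) as [N [-> | ->]]; [apply hright|].
  pose proof (hright N n) as hs. cbv zeta in hs. set (m := (n + 2 * N)%nat) in *.
  assert (he : forall a b, (a + b = n + m \/ a + b = S (S (n + m)) \/ a + b = S (S (S (S (n + m)))))%nat ->
    grid s q a b = grid s q b a).
  { intros a b hab. apply grid_sym.
    destruct hab as [-> | [-> | ->]]; exact h. }
  apply schramm_eq_sym.
  rewrite (he n m), (he (S n) (S m)), (he (S (S n)) m), (he (S (S n)) (S (S m))), (he n (S (S m))) by lia.
  exact hs.
Qed.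

Lemma grid_boundary (c : R) (s q : nat -> R) (n : nat) :
  0 < c <= 2 -> diagonal c s q -> Nat.even (S n) = true ->
  grid s q (S n) 0 * grid s q (S n) 0 = grid s q (S (S n)) 1 * grid s q n 1.
Proof.
  intros hc hd h. apply Nat.even_spec in h. destruct h as [[|N] hN]; [lia|].
  assert (hc1 := fun N k => proj1 (grid_column s q N k)).
  replace (S n) with (0 + 2 * S N)%nat by lia. replace (S (0 + 2 * S N)) with (1 + 2 * S N)%nat by lia.
  replace n with (1 + 2 * N)%nat by lia. rewrite !hc1.
  apply (column_reflection c N (column s q N)); [exact hc|]. now apply column_adjacent.
Qed.
(* The edges of the pattern at a black vertex are real multiples, horizontally of its frame and vertically of [Ci] times
   its frame. *)
Fixpoint frame (g : nat -> nat -> R) (u : C) (n m : nat) : C :=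
  match n, m with
  | O, _ => (- Ci * u)%C
  | S _, O => 1%C
  | S n', S m' =>
      (Ci * frame g u n' m' * ((g (S n') m', (- g n' (S m'))%R) / (g (S n') m', g n' (S m'))))%C
  end.

Lemma frame_SS (g : nat -> nat -> R) (u : C) (n m : nat) :
  frame g u (S n) (S m)
  = (Ci * frame g u n m * ((g (S n) m, (- g n (S m))%R) / (g (S n) m, g n (S m))))%C.
Proof. reflexivity. Qed.

Lemma C_neq_0 (x y : R) : x <> 0 \/ y <> 0 -> ((x, y) : C) <> 0%C.
Proof. intros h e. injection e as e1 e2. tauto. Qed.

Lemma Cmult_eq_0 (x y : C) : (x * y)%C = 0%C -> x = 0%C \/ y = 0%C.
Proof.
  intros h. destruct (classic (x = 0%C)) as [e|e]; [now left|].
  right. replace y with (/ x * (x * y))%C by (field; exact e). rewrite h. ring.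
Qed.

Lemma Ci_neq_0 : Ci <> 0%C.
Proof. apply C_neq_0. right. lra. Qed.

Lemma Cmod_conj_ratio (x y : R) : x <> 0 \/ y <> 0 -> Cmod ((x, (- y)%R) / (x, y))%C = 1.
Proof.
  intros h. assert (h0 := C_neq_0 x y h). rewrite Cmod_div by exact h0.
  replace (Cmod (x, (- y)%R)) with (Cmod (x, y)) by (unfold Cmod; simpl; f_equal; ring).
  field. now apply Rgt_not_eq, Cmod_gt_0.
Qed.

Lemma Cmod_Ci : Cmod Ci = 1.
Proof. unfold Cmod, Ci. simpl. transitivity (sqrt 1); [f_equal; ring | apply sqrt_1]. Qed.

Lemma frame_black (g : nat -> nat -> R) (u : C) (n m : nat) :
  (g (S n) m <> 0 \/ g n (S m) <> 0) ->
  (frame g u (S n) (S m) * (g (S n) m, g n (S m)))%C = (Ci * frame g u n m * (g (S n) m, (- g n (S m))%R))%C.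
Proof.
  intros h. apply C_neq_0 in h. simpl frame. field. exact h.
Qed.

(** The right side is the complex conjugate of the left, so the claim is that the product is real;
    its imaginary part is a multiple of the defect in Schramm's equation. *)
Lemma schramm_closure (r p U l D : R) :
  schramm_eq r p U l D ->
  ((D, (- r)%R) * (p, (- r)%R) * (r, U) * (r, l))%C = ((D, r) * (p, r) * (r, (- U)%R) * (r, (- l)%R))%C.
Proof.
  intros h. unfold schramm_eq in h. unfold Cmult; simpl. f_equal; [ring|].
  apply Rminus_diag_uniq.
  match goal with |- ?x = 0 => replace x with
    (- 2 * r * (r * r * (p + U + l + D) - (p * l * (U + D) + U * D * (p + l)))) by ring end.
  rewrite h. ring.
Qed.

(** The kite with white corners [(n, m)] and [(n + 1, m + 1)] closes: the ways via [(n + 1, m)] and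
    via [(n, m + 1)] give the same displacement. [frame] is defined through the other kind of kite,
    so this has to be proved. *)
Definition white_frames (g : nat -> nat -> R) (E : nat -> nat -> C) (n m : nat) : Prop :=
  (E (S n) m * (g n m, g (S n) (S m)))%C = (Ci * E n (S m) * (g n m, (- g (S n) (S m))%R))%C.

Lemma even_SS (n m : nat) : Nat.even (S n + S m) = Nat.even (n + m).
Proof. now rewrite Nat.add_succ_r. Qed.

(** Four kites meet at the white vertex [(n + 1, m + 1)]. Two close by the definition of [frame],
    one by induction, and Schramm's equation then closes the fourth. On the axes [grid_boundary]
    takes over; at the origin closing is a condition on [u]. *)
Lemma frame_white (c : R) (s q : nat -> R) (u : C) (n m : nat) :
  0 < c <= 2 -> diagonal c s q -> white_frames (grid s q) (frame (grid s q) u) 0 0 ->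
  Nat.even (n + m) = true -> white_frames (grid s q) (frame (grid s q) u) n m.
Proof.
  intros hc hd h0. revert m. induction n as [|n IH]; intros m hm.
  - destruct m as [|m]; [exact h0|]. unfold white_frames. simpl frame.
    pose proof (grid_boundary c s q m hc hd hm) as hb.
    rewrite (grid_sym s q (S m) 0) in hb by (now rewrite Nat.add_0_r).
    rewrite (grid_sym s q (S (S m)) 1) in hb by (now rewrite Nat.add_1_r).
    rewrite (grid_sym s q m 1) in hb by (now rewrite Nat.add_1_r).
    assert (hr := grid_pos c s q 0 (S m) hc hd hm ltac:(lia)).
    set (r := grid s q 0 (S m)) in *. set (U := grid s q 1 (S (S m))) in *. set (p := grid s q 1 m) in *.
    assert (hz : ((p, r) : C) <> 0%C) by (apply C_neq_0; lra).
    replace (Ci * (- Ci * u) * ((p, (- r)%R) / (p, r)) * (r, U))%C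
      with (Ci * (- Ci * u) * (((p, (- r)%R) * (r, U)) / (p, r)))%C by (field; exact hz).
    replace ((p, (- r)%R) * (r, U))%C with ((p, r) * (r, (- U)%R))%C; [field; exact hz|].
    unfold Cmult; simpl. f_equal; nra.
  - destruct m as [|m].
    + unfold white_frames. simpl frame.
      rewrite Nat.add_0_r in hm.
      pose proof (grid_boundary c s q n hc hd hm) as hb.
      assert (hr := grid_pos c s q (S n) 0 hc hd ltac:(now rewrite Nat.add_0_r) ltac:(lia)).
      assert (hE : frame (grid s q) u n 0 = 1%C).
      { destruct n as [|n]; [discriminate hm | reflexivity]. }
      rewrite hE.
      set (r := grid s q (S n) 0) in *. set (U := grid s q (S (S n)) 1) in *. set (l := grid s q n 1) in *.
      assert (hz : ((r, l) : C) <> 0%C) by (apply C_neq_0; lra).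
      replace (Ci * (Ci * 1 * ((r, (- l)%R) / (r, l))) * (r, (- U)%R))%C
        with (Ci * Ci * ((r, (- l)%R) * (r, (- U)%R)) / (r, l))%C by (field; exact hz).
      replace (Ci * Ci * ((r, (- l)%R) * (r, (- U)%R)))%C with ((r, l) * (r, U))%C; [field; exact hz|].
      unfold Ci, Cmult; simpl. f_equal; nra.
    + rewrite even_SS in hm. specialize (IH m hm).
      pose proof (grid_schramm c s q n m hc hd hm) as hs. apply schramm_closure in hs.
      unfold white_frames in *. rewrite !frame_SS.
      assert (hr := grid_pos c s q (S n) (S m) hc hd ltac:(now rewrite even_SS) ltac:(lia)).
      set (a := frame (grid s q) u (S n) m) in *.
      set (b := frame (grid s q) u n (S m)) in *.
      set (r := grid s q (S n) (S m)) in *.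
      set (p := grid s q (S (S n)) m) in *. set (l := grid s q n (S (S m))) in *.
      set (D := grid s q n m) in *. set (U := grid s q (S (S n)) (S (S m))) in *.
      assert (hz1 : ((D, r) : C) <> 0%C) by (apply C_neq_0; lra).
      assert (hz2 : ((p, r) : C) <> 0%C) by (apply C_neq_0; lra).
      assert (hz3 : ((r, l) : C) <> 0%C) by (apply C_neq_0; lra).
      assert (ea : a = (Ci * b * (D, (- r)%R) / (D, r))%C).
      { rewrite <- IH. field. exact hz1. }
      transitivity (Ci * Ci * b * ((D, (- r)%R) * (p, (- r)%R) * (r, U) * (r, l)) / ((D, r) * (p, r) * (r, l)))%C.
      * rewrite ea. field. auto.
      * rewrite hs. field. auto.
Qed.

Lemma frame_unit (g : nat -> nat -> R) (u : C) (n m : nat) :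
  (forall n m, Nat.even (n + m) = true -> (n + m <> 0)%nat -> 0 < g n m) ->
  Cmod u = 1 -> Nat.even (n + m) = false -> Cmod (frame g u n m) = 1.
Proof.
  intros hg hu. revert m. induction n as [|n IH]; intros m hm.
  - simpl. rewrite Cmod_mult, Cmod_opp, Cmod_Ci, hu. ring.
  - destruct m as [|m].
    + simpl. apply Cmod_1.
    + rewrite even_SS in hm. simpl frame. rewrite !Cmod_mult, Cmod_Ci, IH by exact hm.
      rewrite Cmod_conj_ratio; [ring|]. left. apply Rgt_not_eq, hg; [|lia].
      rewrite Nat.add_succ_l, Nat.even_succ, <- Nat.negb_even, hm. reflexivity.
Qed.

(** * From the circle pattern to the map *)

(** Every edge joins a white and a black vertex: the radius is taken at the white end, the direction
    at the black end. *)
Definition h_edge (f : nat -> nat -> C) (la : R) (g : nat -> nat -> R) (E : nat -> nat -> C) (n m : nat) : Prop :=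
  (f (S n) m - f n m = RtoC la *
    (if Nat.even (n + m) then RtoC (g n m) * E (S n) m else RtoC (g (S n) m) * E n m))%C.

Definition v_edge (f : nat -> nat -> C) (la : R) (g : nat -> nat -> R) (E : nat -> nat -> C) (n m : nat) : Prop :=
  (f n (S m) - f n m = RtoC la * Ci *
    (if Nat.even (n + m) then RtoC (g n m) * E n (S m) else RtoC (g n (S m)) * E n m))%C.

(** The cross-ratio equation is affine in the fourth point, with coefficient [(b - a) + (d - a)] up
    to sign. *)
Lemma cross_ratio_unique (a b d x x0 : C) :
  ((a - b) * (x - d))%C = (- ((b - x) * (d - a)))%C ->
  ((a - b) * (x0 - d))%C = (- ((b - x0) * (d - a)))%C ->
  ((b - a) + (d - a))%C <> 0%C -> x = x0.
Proof.
  intros h h0 hne.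
  assert (e : ((x - x0) * ((b - a) + (d - a)))%C = 0%C).
  { replace ((x - x0) * ((b - a) + (d - a)))%C with
      ((((a - b) * (x0 - d)) - - ((b - x0) * (d - a))) - (((a - b) * (x - d)) - - ((b - x) * (d - a))))%C by ring.
    rewrite h, h0. ring. }
  apply Cmult_eq_0 in e. destruct e as [e|e]; [|contradiction].
  replace x with ((x - x0) + x0)%C by ring. rewrite e. ring.
Qed.

Lemma pair_C (x y : R) : ((x, y) : C) = (RtoC x + Ci * RtoC y)%C.
Proof. unfold RtoC, Ci, Cplus, Cmult; simpl. f_equal; ring. Qed.

Lemma pair_C_opp (x y : R) : ((x, (- y)%R) : C) = (RtoC x - Ci * RtoC y)%C.
Proof. rewrite pair_C, RtoC_opp. ring. Qed.

Lemma Ci_Ci : (Ci * Ci)%C = (- (1))%C.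
Proof. unfold Ci, Cmult, Copp, RtoC; simpl. f_equal; ring. Qed.

Lemma C_eq_from_diff (x y z : C) : (x - y)%C = z -> z = 0%C -> x = y.
Proof. intros h1 h2. replace x with (x - y + y)%C by ring. rewrite h1, h2. ring. Qed.

(** The fourth corner of the kite satisfies the same cross-ratio equation, so by
    [cross_ratio_unique] it is the value of [f]; the two edges at [(n, m)] thus determine the
    opposite ones. *)
Lemma quad_step (f : nat -> nat -> C) (la : R) (g : nat -> nat -> R) (E : nat -> nat -> C) (n m : nat) :
  la <> 0 -> cr_num f n m = (- cr_den f n m)%C ->
  (Nat.even (n + m) = true -> g n m <> 0 /\ E n (S m) <> 0%C /\ white_frames g E n m) ->
  (Nat.even (n + m) = false -> E n m <> 0%C /\ (g (S n) m <> 0 \/ g n (S m) <> 0) /\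
     (E (S n) (S m) * (g (S n) m, g n (S m)))%C = (Ci * E n m * (g (S n) m, (- g n (S m))%R))%C) ->
  h_edge f la g E n m -> v_edge f la g E n m ->
  h_edge f la g E n (S m) /\ v_edge f la g E (S n) m.
Proof.
  intros hla hcr hw hb hh hv. unfold h_edge, v_edge in *. unfold cr_num, cr_den in hcr.
  assert (hla' : RtoC la <> 0%C) by (intros e; apply RtoC_inj in e; contradiction).
  rewrite Nat.add_succ_r, Nat.add_succ_l, Nat.even_succ, <- Nat.negb_even.
  destruct (Nat.even (n + m)); simpl negb; cbv iota in *.
  - destruct hw as (hg & hE & hf); [reflexivity|]. unfold white_frames in hf.
    rewrite pair_C, pair_C_opp in hf.
    set (r := g n m) in *. set (r' := g (S n) (S m)) in *.
    set (e := E (S n) m) in *. set (e' := E n (S m)) in *.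
    assert (hr : RtoC r <> 0%C) by (intros h; apply RtoC_inj in h; contradiction).
    set (a := f n m) in *. set (b := f (S n) m) in *. set (d := f n (S m)) in *. set (x := f (S n) (S m)) in *.
    assert (hdiff : (b + RtoC la * Ci * (RtoC r' * e) - d)%C = (RtoC la * (RtoC r' * e'))%C).
    { replace (b + RtoC la * Ci * (RtoC r' * e) - d)%C
        with ((b - a) - (d - a) + RtoC la * Ci * (RtoC r' * e))%C by ring.
      rewrite hh, hv.
      transitivity (RtoC la * (e * (RtoC r + Ci * RtoC r')) - RtoC la * Ci * RtoC r * e')%C; [ring|].
      rewrite hf. transitivity (- (Ci * Ci) * (RtoC la * (RtoC r' * e')))%C; [ring|]. rewrite Ci_Ci. ring. }
    assert (hx : x = (b + RtoC la * Ci * (RtoC r' * e))%C).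
    { apply (cross_ratio_unique a b d); [exact hcr| |].
      - rewrite hdiff. replace (a - b)%C with (- (b - a))%C by ring. rewrite hh, hv.
        transitivity ((Ci * Ci) * (RtoC la * (RtoC r' * e) * (RtoC la * (RtoC r * e'))))%C; [rewrite Ci_Ci; ring | ring].
      - rewrite hh, hv. intros h0.
        replace (RtoC la * (RtoC r * e) + RtoC la * Ci * (RtoC r * e'))%C
          with (RtoC la * RtoC r * (e + Ci * e'))%C in h0 by ring.
        apply Cmult_eq_0 in h0. destruct h0 as [h0|h0].
        + apply Cmult_eq_0 in h0. tauto.
        (* If the coefficient vanished in this way, the closing condition would give [2 * r = 0]. *)
        + assert (he : e = (- (Ci * e'))%C).
          { replace e with ((e + Ci * e') - Ci * e')%C by ring. rewrite h0. ring. }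
          rewrite he in hf.
          assert (h1 : (Ci * e' * (RtoC 2 * RtoC r))%C = 0%C).
          { apply (C_eq_from_diff _ _ (Ci * e' * (RtoC r - Ci * RtoC r') - - (Ci * e') * (RtoC r + Ci * RtoC r'))%C);
              [replace (RtoC 2) with (1 + 1)%C by (rewrite <- RtoC_plus; f_equal; ring); ring|]. rewrite hf. ring. }
          apply Cmult_eq_0 in h1. destruct h1 as [h1|h1]; apply Cmult_eq_0 in h1; destruct h1 as [h1|h1]; try contradiction.
          * now apply Ci_neq_0.
          * apply RtoC_inj in h1. lra. }
    split.
    + rewrite hx. exact hdiff.
    + rewrite hx. ring.
  - destruct hb as (hE & hg & hf); [reflexivity|].
    assert (hgz := C_neq_0 _ _ hg).
    rewrite pair_C, pair_C_opp in hf. rewrite pair_C in hgz.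
    set (r1 := g (S n) m) in *. set (r2 := g n (S m)) in *.
    set (e0 := E n m) in *. set (e1 := E (S n) (S m)) in *.
    set (a := f n m) in *. set (b := f (S n) m) in *. set (d := f n (S m)) in *. set (x := f (S n) (S m)) in *.
    assert (hdiff : (d + RtoC la * (RtoC r2 * e1) - b)%C = (RtoC la * Ci * (RtoC r1 * e1))%C).
    { replace (d + RtoC la * (RtoC r2 * e1) - b)%C
        with ((d - a) - (b - a) + RtoC la * (RtoC r2 * e1))%C by ring.
      rewrite hh, hv.
      transitivity (RtoC la * (RtoC r2 * e1) + RtoC la * ((Ci * Ci) * RtoC r1 * e0 + Ci * RtoC r2 * e0))%C;
        [rewrite Ci_Ci; ring|].
      transitivity (RtoC la * (RtoC r2 * e1) + RtoC la * Ci * (Ci * e0 * (RtoC r1 - Ci * RtoC r2))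
        + RtoC la * Ci * RtoC r2 * e0 * (1 + Ci * Ci))%C; [ring|].
      rewrite <- hf.
      transitivity (RtoC la * Ci * (RtoC r1 * e1) + RtoC la * (RtoC r2 * e1 + RtoC r2 * Ci * e0) * (1 + Ci * Ci))%C; [ring|].
      rewrite Ci_Ci. ring. }
    assert (hx : x = (d + RtoC la * (RtoC r2 * e1))%C).
    { apply (cross_ratio_unique a b d); [exact hcr| |].
      - replace (b - (d + RtoC la * (RtoC r2 * e1)))%C with (- (d + RtoC la * (RtoC r2 * e1) - b))%C by ring.
        rewrite hdiff. replace (a - b)%C with (- (b - a))%C by ring. rewrite hh, hv.
        transitivity ((Ci * Ci) * (RtoC la * (RtoC r1 * e0) * (RtoC la * (RtoC r2 * e1))))%C; [rewrite Ci_Ci; ring | ring].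
      - rewrite hh, hv. intros h0.
        replace (RtoC la * (RtoC r1 * e0) + RtoC la * Ci * (RtoC r2 * e0))%C
          with (RtoC la * e0 * (RtoC r1 + Ci * RtoC r2))%C in h0 by ring.
        apply Cmult_eq_0 in h0. destruct h0 as [h0|h0]; [|contradiction].
        apply Cmult_eq_0 in h0. tauto. }
    split.
    + rewrite hx. ring.
    + rewrite hx. exact hdiff.
Qed.

(** * The two axes *)

(** Centres sit at even indices, so each radius except the one at the origin is traversed twice:
    [A 0, A 1, A 1, A 2, A 2, ...]. *)
Fixpoint axis_position (A : nat -> R) (n : nat) : R :=
  match n with O => 0 | S n' => axis_position A n' + A (Nat.div2 (S n')) end.

Lemma axis_position_value (c : R) (A : nat -> R) (k : nat) :
  (forall N, (2 * INR N + 2 - c) * A (S N) = (2 * INR N + c) * A N) ->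
  c * axis_position A (2 * k) = 2 * INR k * A k /\
  c * axis_position A (S (2 * k)) = (2 * INR k + c) * A k.
Proof.
  intros hA.
  assert (hodd : forall k, axis_position A (S (2 * k)) = axis_position A (2 * k) + A k).
  { intros j. simpl axis_position at 1. f_equal. f_equal.
    change (Nat.div2 (S (2 * j)) = j). apply Nat.div2_succ_double. }
  assert (heven : forall k, axis_position A (2 * S k) = axis_position A (S (2 * k)) + A (S k)).
  { intros j. replace (2 * S j)%nat with (S (S (2 * j))) by lia.
    change (axis_position A (S (2 * j)) + A (S (Nat.div2 (2 * j))) = axis_position A (S (2 * j)) + A (S j)).
    now rewrite Nat.div2_double. }
  assert (h : c * axis_position A (2 * k) = 2 * INR k * A k).
  { induction k as [|k IH]; [simpl; ring|].
    rewrite heven, hodd, S_INR. specialize (hA k). lra. }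
  split; [exact h|]. rewrite hodd. lra.
Qed.

(** The constraint on an axis is affine in [F (n + 2)], and along [axis_position] its coefficient is
    nonzero for [n >= 1]. At [n = 0] the coefficient is a multiple of [c - 2], hence [F 2] is
    given. *)
Lemma axis_unique (c la : R) (A : nat -> R) (u : C) (F : nat -> C) :
  0 < c <= 2 -> la <> 0 -> u <> 0%C ->
  (forall N, 0 < A (S N)) ->
  (forall N, (2 * INR N + 2 - c) * A (S N) = (2 * INR N + c) * A N) ->
  F 0%nat = 0%C -> F 1%nat = (RtoC (la * A 0%nat) * u)%C ->
  F 2%nat = (RtoC (la * (A 0%nat + A 1%nat)) * u)%C ->
  (forall n, (RtoC c * F (S n) * (F (S (S n)) - F n))%C
     = (RtoC (2 * INR (S n)) * ((F (S (S n)) - F (S n)) * (F (S n) - F n)))%C) ->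
  forall n, F n = (RtoC (la * axis_position A n) * u)%C.
Proof.
  intros hc hla hu hpos hA h0 h1 h2 hrec.
  assert (h : forall n, F n = (RtoC (la * axis_position A n) * u)%C /\
     F (S n) = (RtoC (la * axis_position A (S n)) * u)%C); [|intros n; apply h].
  induction n as [|n [IH1 IH2]].
  - split; [rewrite h0; simpl; rewrite Rmult_0_r; ring|]. rewrite h1. simpl. now rewrite Rplus_0_l.
  - split; [exact IH2|]. destruct n as [|n].
    { rewrite h2. simpl. now rewrite Rplus_0_l. }
    specialize (hrec (S n)). rewrite IH1, IH2 in hrec.
    set (a := axis_position A (S n)) in *. set (b := axis_position A (S (S n))) in *.
    set (d := axis_position A (S (S (S n)))).
    assert (hb : c * b * (d - a) = 2 * INR (S (S n)) * ((d - b) * (b - a)) /\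
       c * b - 2 * INR (S (S n)) * (b - a) <> 0).
    { destruct (Nat.Even_or_Odd (S (S n))) as [[k hk]|[k hk]].
      - destruct k as [|k]; [lia|].
        assert (e1 : b = a + A (S k)).
        { unfold b, a. change (axis_position A (S (S n))) with (axis_position A (S n) + A (Nat.div2 (S (S n)))).
          now rewrite hk, Nat.div2_double. }
        assert (e2 : d = b + A (S k)).
        { unfold d, b. change (axis_position A (S (S (S n)))) with (axis_position A (S (S n)) + A (Nat.div2 (S (S (S n))))).
          now rewrite hk, Nat.div2_succ_double. }
        assert (e3 : c * b = 2 * INR (S k) * A (S k)).
        { unfold b. rewrite hk. now apply axis_position_value. }
        rewrite hk, mult_INR. change (INR 2) with (1 + 1). rewrite e3, e2, e1. assert (hp := hpos k).
        assert (hk' : 0 < INR (S k)) by (apply lt_0_INR; lia).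
        split; [ring|]. assert (0 < INR (S k) * A (S k)) by nra. lra.
      - destruct k as [|k]; [lia|].
        assert (e1 : b = a + A (S k)).
        { unfold b, a. change (axis_position A (S (S n))) with (axis_position A (S n) + A (Nat.div2 (S (S n)))).
          now rewrite hk, Nat.add_1_r, Nat.div2_succ_double. }
        assert (e2 : d = b + A (S (S k))).
        { unfold d, b. change (axis_position A (S (S (S n)))) with (axis_position A (S (S n)) + A (Nat.div2 (S (S (S n))))).
          rewrite hk. replace (S (2 * S k + 1)) with (2 * S (S k))%nat by lia. now rewrite Nat.div2_double. }
        assert (e3 : c * b = (2 * INR (S k) + c) * A (S k)).
        { unfold b. rewrite hk, Nat.add_1_r. now apply axis_position_value. }
        rewrite hk, plus_INR, mult_INR. change (INR 2) with (1 + 1). change (INR 1) with 1.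
        assert (hp := hpos k). assert (hAk := hA (S k)).
        assert (hk' : 1 <= INR (S k)) by (rewrite S_INR; assert (h := pos_INR k); lra).
        rewrite e3, e2, e1. split.
        + replace (a + A (S k) + A (S (S k)) - a) with (A (S k) + A (S (S k))) by ring.
          replace (a + A (S k) + A (S (S k)) - (a + A (S k))) with (A (S (S k))) by ring.
          replace (a + A (S k) - a) with (A (S k)) by ring.
          apply Rminus_diag_uniq.
          match goal with |- ?x = 0 => replace x with
            (A (S k) * ((2 * INR (S k) + c) * A (S k) - (2 * INR (S k) + 2 - c) * A (S (S k)))) by ring end.
          rewrite hAk. ring.
        + replace (a + A (S k) - a) with (A (S k)) by ring.
          replace ((2 * INR (S k) + c) * A (S k) - 2 * ((1 + 1) * INR (S k) + 1) * A (S k))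
            with (- ((2 * INR (S k) + 2 - c) * A (S k))) by ring.
          apply Ropp_neq_0_compat, Rgt_not_eq, Rmult_lt_0_compat; lra. }
    destruct hb as [hb1 hb2].
    assert (e : (RtoC (la * (c * b - 2 * INR (S (S n)) * (b - a))) * u * (F (S (S (S n))) - RtoC (la * d) * u))%C = 0%C).
    { set (X := F (S (S (S n)))) in *. set (k2 := 2 * INR (S (S n))) in *.
      transitivity ((RtoC c * (RtoC (la * b) * u) * (X - RtoC (la * a) * u)
          - RtoC k2 * ((X - RtoC (la * b) * u) * (RtoC (la * b) * u - RtoC (la * a) * u)))
        - RtoC la * RtoC la * u * u * (RtoC (c * b * (d - a)) - RtoC (k2 * ((d - b) * (b - a)))))%C.
      - rewrite !RtoC_mult, !RtoC_minus, !RtoC_mult, !RtoC_minus. ring.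
      - rewrite hrec, hb1. ring. }
    apply Cmult_eq_0 in e. destruct e as [e|e].
    + apply Cmult_eq_0 in e. destruct e as [e|e]; [|contradiction]. apply RtoC_inj in e.
      exfalso. apply Rmult_integral in e. tauto.
    + apply (C_eq_from_diff _ _ _ e). reflexivity.
Qed.

Lemma axis_edges (c la : R) (A : nat -> R) (u : C) (F : nat -> C) :
  0 < c <= 2 -> la <> 0 -> u <> 0%C ->
  (forall N, 0 < A (S N)) ->
  (forall N, (2 * INR N + 2 - c) * A (S N) = (2 * INR N + c) * A N) ->
  F 0%nat = 0%C -> F 1%nat = (RtoC (la * A 0%nat) * u)%C ->
  (c = 2 -> F 2%nat = (RtoC (la * A 1%nat) * u)%C) ->
  (forall n, (RtoC c * F (S n) * (F (S (S n)) - F n))%C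
     = (RtoC (2 * INR (S n)) * ((F (S (S n)) - F (S n)) * (F (S n) - F n)))%C) ->
  forall n, (F (S n) - F n)%C = (RtoC la * RtoC (A (Nat.div2 (S n))) * u)%C.
Proof.
  intros hc hla hu hpos hA h0 h1 h2 hrec n.
  assert (hA0 := hA 0%nat). simpl INR in hA0.
  assert (h2' : F 2%nat = (RtoC (la * (A 0%nat + A 1%nat)) * u)%C).
  { destruct (Req_dec c 2) as [e|e].
    - rewrite (h2 e). replace (A 0%nat) with 0 by (subst c; lra). now rewrite Rplus_0_l.
    - specialize (hrec 0%nat). rewrite h0, h1 in hrec. simpl INR in hrec.
      assert (hA0' : 0 < A 0%nat) by (specialize (hpos 0%nat); nra).
      assert (hz : (RtoC (la * A 0%nat * (c - 2)) * u * (F 2%nat - RtoC (la * (A 0%nat + A 1%nat)) * u))%C = 0%C).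
      { transitivity ((RtoC c * (RtoC (la * A 0%nat) * u) * (F 2%nat - 0)
          - RtoC (2 * 1) * ((F 2%nat - RtoC (la * A 0%nat) * u) * (RtoC (la * A 0%nat) * u - 0)))
          + RtoC la * RtoC la * RtoC (A 0%nat) * u * u * (RtoC ((2 * 0 + 2 - c) * A 1%nat) - RtoC ((2 * 0 + c) * A 0%nat)))%C.
        - rewrite !RtoC_mult, !RtoC_minus, !RtoC_plus, !RtoC_mult. ring.
        - rewrite hrec, hA0. ring. }
      apply Cmult_eq_0 in hz. destruct hz as [hz|hz].
      + apply Cmult_eq_0 in hz. destruct hz as [hz|hz]; [|contradiction]. apply RtoC_inj in hz. exfalso.
        apply Rmult_integral in hz. destruct hz as [hz|hz]; [|lra]. apply Rmult_integral in hz. lra.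
      + apply (C_eq_from_diff _ _ _ hz). reflexivity. }
  rewrite !(axis_unique c la A u F hc hla hu hpos hA h0 h1 h2' hrec).
  change (axis_position A (S n)) with (axis_position A n + A (Nat.div2 (S n))).
  rewrite !RtoC_mult, RtoC_plus. ring.
Qed.
Lemma constraint_mult_h_axis (c : R) (f : nat -> nat -> C) (n : nat) :
  constraint_mult c f ->
  (RtoC c * f (S n) 0%nat * (f (S (S n)) 0%nat - f n 0%nat))%C
  = (RtoC (2 * INR (S n)) * ((f (S (S n)) 0%nat - f (S n) 0%nat) * (f (S n) 0%nat - f n 0%nat)))%C.
Proof.
  intros h. specialize (h (S n) 0%nat). unfold cn_den, cm_den, cn_num, cm_num in h.
  rewrite !Cmult_1_r in h. rewrite h. ring.
Qed.

Lemma constraint_mult_v_axis (c : R) (f : nat -> nat -> C) (m : nat) :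
  constraint_mult c f ->
  (RtoC c * f 0%nat (S m) * (f 0%nat (S (S m)) - f 0%nat m))%C
  = (RtoC (2 * INR (S m)) * ((f 0%nat (S (S m)) - f 0%nat (S m)) * (f 0%nat (S m) - f 0%nat m)))%C.
Proof.
  intros h. specialize (h 0%nat (S m)). unfold cn_den, cm_den, cn_num, cm_num in h.
  rewrite !Cmult_1_r in h. rewrite h. ring.
Qed.

Lemma constraint_constraint_mult (c : R) (f : nat -> nat -> C) : constraint c f -> constraint_mult c f.
Proof.
  intros h n m. destruct (h n m) as (h1 & h2 & h3). rewrite h3. field. auto.
Qed.

Lemma grid_axis (s q : nat -> R) (N : nat) :
  grid s q (2 * N) 0 = column s q N 0 /\ grid s q 0 (2 * N) = column s q N 0.
Proof. exact (grid_column s q N 0). Qed.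

Lemma frame_axis (g : nat -> nat -> R) (u : C) (n m : nat) :
  frame g u (S n) 0 = 1%C /\ frame g u 0 m = (- Ci * u)%C.
Proof. split; [reflexivity | now destruct m]. Qed.

(** The relation between [u] and [s] says that the kite at the origin closes: [u] is the direction
    of the second axis, and for [s 0 > 0] half its angle has tangent [s 1 / s 0]. Once both axes are
    known, the quadrilaterals are filled in row by row. *)
Lemma pattern_edges (c la : R) (s q : nat -> R) (u : C) (f : nat -> nat -> C) :
  0 < c <= 2 -> 0 < la -> diagonal c s q -> Cmod u = 1 ->
  ((s 0%nat, s 1%nat) : C) = (u * (s 0%nat, (- s 1%nat)%R))%C ->
  discrete_conformal_mult f -> constraint_mult c f ->
  f 0%nat 0%nat = 0%C -> f 1%nat 0%nat = RtoC (la * s 0%nat) -> f 0%nat 1%nat = (RtoC (la * s 0%nat) * u)%C ->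
  (c = 2 -> f 2%nat 0%nat = RtoC (la * q 1%nat) /\ f 0%nat 2%nat = (RtoC (la * q 1%nat) * u)%C /\
     f 1%nat 1%nat = (RtoC la * Ci * RtoC (s 1%nat))%C) ->
  forall n m, h_edge f la (grid s q) (frame (grid s q) u) n m /\ v_edge f la (grid s q) (frame (grid s q) u) n m.
Proof.
  intros hc hla hd hu hcl hcr hco h00 h10 h01 h2.
  set (g := grid s q). set (E := frame g u).
  assert (hu0 : u <> 0%C) by (intros e; rewrite e, Cmod_0 in hu; lra).
  assert (hg : forall n m, Nat.even (n + m) = true -> (n + m <> 0)%nat -> 0 < g n m).
  { intros. now apply (grid_pos c). }
  assert (hA : forall N, (2 * INR N + 2 - c) * column s q (S N) 0 = (2 * INR N + c) * column s q N 0).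
  { intros N. apply (column_adjacent c s q N hc hd). }
  assert (hA0 : forall N, 0 < column s q (S N) 0).
  { intros N. apply (column_pos c); auto; lia. }
  assert (hw0 : white_frames g E 0 0).
  { unfold white_frames, E, g. simpl frame. rewrite grid_00, grid_11, Cmult_1_l, hcl.
    transitivity (- (Ci * Ci) * (u * (s 0%nat, (- s 1%nat)%R)))%C; [rewrite Ci_Ci|]; ring. }
  assert (hw : forall n m, Nat.even (n + m) = true -> white_frames g E n m).
  { intros n m. now apply (frame_white c). }
  assert (hE : forall n m, Nat.even (n + m) = false -> E n m <> 0%C).
  { intros n m h e. apply (frame_unit g u n m hg hu) in h. fold E in h. rewrite e, Cmod_0 in h. lra. }
  assert (hh : forall n, h_edge f la g E n 0).
  { intros n. unfold h_edge.
    rewrite (axis_edges c la (fun N => column s q N 0) 1%C (fun n => f n 0%nat)); auto.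
    - rewrite Nat.add_0_r. destruct (Nat.even n) eqn:hn.
      + apply Nat.even_spec in hn. destruct hn as [k ->]. rewrite Nat.div2_succ_double.
        unfold g. rewrite (proj1 (grid_axis s q k)). unfold E. rewrite (proj1 (frame_axis g u (2 * k) 0)). ring.
      + assert (ho : Nat.odd n = true) by (rewrite <- Nat.negb_even, hn; reflexivity).
        apply Nat.odd_spec in ho. destruct ho as [k ->].
        replace (S (2 * k + 1)) with (2 * S k)%nat by lia. rewrite Nat.div2_double.
        unfold g. rewrite (proj1 (grid_axis s q (S k))). rewrite Nat.add_1_r.
        unfold E. rewrite (proj1 (frame_axis g u (2 * k) 0)). ring.
    - lra.
    - intros e; apply RtoC_inj in e; lra.
    - rewrite h10, Cmult_1_r. reflexivity.
    - intros e. rewrite Cmult_1_r. now apply h2.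
    - intros k. now apply constraint_mult_h_axis. }
  assert (hv : forall m, v_edge f la g E 0 m).
  { intros m. unfold v_edge.
    rewrite (axis_edges c la (fun N => column s q N 0) u (fun m => f 0%nat m)); auto.
    - assert (hi : forall a b : C, (a * b * u = a * Ci * (b * (- Ci * u)))%C).
      { intros a b. transitivity (- (Ci * Ci) * (a * b * u))%C; [rewrite Ci_Ci|]; ring. }
      unfold E. rewrite !(proj2 (frame_axis g u 0 _)).
      rewrite Nat.add_0_l. destruct (Nat.even m) eqn:hn.
      + apply Nat.even_spec in hn. destruct hn as [k ->]. rewrite Nat.div2_succ_double.
        unfold g. rewrite (proj2 (grid_axis s q k)). apply hi.
      + assert (ho : Nat.odd m = true) by (rewrite <- Nat.negb_even, hn; reflexivity).
        apply Nat.odd_spec in ho. destruct ho as [k ->].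
        replace (S (2 * k + 1)) with (2 * S k)%nat by lia. rewrite Nat.div2_double.
        unfold g. rewrite (proj2 (grid_axis s q (S k))). apply hi.
    - lra.
    - intros e. now apply h2.
    - intros k. now apply constraint_mult_v_axis. }
  assert (hstep : forall n m, h_edge f la g E n m -> v_edge f la g E n m ->
    h_edge f la g E n (S m) /\ v_edge f la g E (S n) m).
  { intros n m h1 h1'.
    (* For [c = 2] three corners of the first quadrilateral coincide, its cross-ratio equation does
       not determine [f 1 1], and the prescribed value is used. *)
    destruct (classic ((n + m)%nat = 0%nat /\ s 0%nat = 0)) as [[e0 e]|hne].
    - assert (n = 0%nat) as -> by lia. assert (m = 0%nat) as -> by lia. clear e0.
      assert (hA1 := hA 0%nat). change (column s q 0 0) with (s 0%nat) in hA1. rewrite e in hA1.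
      assert (hp1 := hA0 0%nat). simpl INR in hA1.
      assert (c = 2) as -> by nra. destruct h2 as (_ & _ & h11); [reflexivity|].
      assert (hs1 : 0 < s 1%nat) by apply hd.
      assert (hu1 : u = (- (1))%C).
      { rewrite e in hcl. destruct u as [u1 u2]. unfold Cmult in hcl. simpl in hcl.
        injection hcl as e1 e2. unfold Copp, RtoC. simpl. f_equal; nra. }
      unfold h_edge, v_edge. change (Nat.even (0 + 1)) with false. change (Nat.even (1 + 0)) with false.
      cbv iota. unfold E, g. rewrite (proj1 (frame_axis _ u 0 0)), (proj2 (frame_axis _ u 0 1)).
      rewrite grid_11, h11, h10, h01, e, hu1, Rmult_0_r. split; ring.
    - apply quad_step; auto; try lra.
      + intros h. split; [|split; auto].
        * destruct (Nat.eq_dec (n + m) 0) as [e0|e0]; [|apply Rgt_not_eq; now apply hg].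
          assert (n = 0%nat) as -> by lia. assert (m = 0%nat) as -> by lia.
          unfold g. rewrite grid_00. intros e. apply hne. auto.
        * apply hE. now rewrite Nat.add_succ_r, Nat.even_succ, <- Nat.negb_even, h.
      + intros h. assert (hp : 0 < g (S n) m).
        { apply hg; [|lia]. now rewrite Nat.add_succ_l, Nat.even_succ, <- Nat.negb_even, h. }
        split; [auto|]. split; [left; lra|]. apply frame_black. left. lra. }
  assert (hrow : forall m, (forall n, h_edge f la g E n m) -> forall n, v_edge f la g E n m).
  { intros m h n. induction n as [|n IH]; [apply hv|]. now apply hstep. }
  intros n m. revert n. induction m as [|m IH]; intros n.
  - split; [apply hh | now apply hrow].
  - assert (h : forall n, h_edge f la g E n (S m)) by (intros k; apply hstep; apply IH).
    split; [apply h | now apply hrow].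
Qed.

(** Entry [k] of column [N] is [R_{N, N + k}], whence [M = k + |N0|]; the symmetry of [grid] covers
    negative [N0]. *)
Lemma pattern_radius (c la : R) (s q : nat -> R) (u : C) (f : nat -> nat -> C) (N0 : Z) (k : nat) :
  0 < c <= 2 -> 0 < la -> diagonal c s q -> Cmod u = 1 ->
  (forall n m, h_edge f la (grid s q) (frame (grid s q) u) n m) ->
  radius f N0 (k + Z.abs_nat N0) = la * column s q (Z.abs_nat N0) k.
Proof.
  intros hc hla hd hu h. unfold radius.
  assert (hn : exists n m, Z.to_nat (Z.of_nat (k + Z.abs_nat N0) + N0) = n /\
     Z.to_nat (Z.of_nat (k + Z.abs_nat N0) - N0) = m /\ Nat.even (n + m) = true /\
     grid s q n m = column s q (Z.abs_nat N0) k).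
  { destruct (Z.le_ge_cases 0 N0) as [hN|hN].
    - exists (k + 2 * Z.abs_nat N0)%nat, k. repeat split; try lia.
      + apply Nat.even_spec. exists (k + Z.abs_nat N0)%nat. lia.
      + apply grid_column.
    - exists k, (k + 2 * Z.abs_nat N0)%nat. repeat split; try lia.
      + apply Nat.even_spec. exists (k + Z.abs_nat N0)%nat. lia.
      + apply grid_column. }
  destruct hn as (n & m & -> & -> & he & hg). rewrite <- hg.
  specialize (h n m). unfold h_edge in h. rewrite he in h. rewrite h.
  assert (hpos : 0 <= grid s q n m).
  { destruct (Nat.eq_dec (n + m) 0) as [e|e]; [|apply Rlt_le; now apply (grid_pos c)].
    assert (n = 0%nat) as -> by lia. assert (m = 0%nat) as -> by lia. rewrite grid_00. apply hd. }
  rewrite !Cmod_mult, !Cmod_R, (Rabs_pos_eq la), (Rabs_pos_eq (grid s q n m)) by lra.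
  rewrite (frame_unit (grid s q)); auto.
  - ring.
  - intros a b. now apply (grid_pos c).
  - now rewrite Nat.add_succ_l, Nat.even_succ, <- Nat.negb_even, he.
Qed.
(** * Asymptotics *)

(** The Painleve equation involves both neighbours, so no index can be improved alone: the induction
    carries a bound for a whole tail and sharpens it from [b k] to [b (S k)] beyond [k]. *)
Lemma tail_bound (x b : nat -> R) (K : nat) :
  (forall j, (K <= j)%nat -> x j <= b K) ->
  (forall k j, (K <= k)%nat -> (k < j)%nat -> (forall i, (k <= i)%nat -> x i <= b k) -> x j <= b (S k)) ->
  forall k, (K <= k)%nat -> x k <= b k.
Proof.
  intros h0 hs.
  assert (h : forall k, (K <= k)%nat -> forall j, (k <= j)%nat -> x j <= b k); [|intros k hk; now apply (h k)].
  intros k hk. induction hk as [|k hk IH]; [exact h0|].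
  intros j hj. apply (hs k j); auto.
Qed.

(** * First and second order bounds at 0 *)

Lemma mvt_linear (g g' : R -> R) (L r : R) :
  (forall x, Rabs x <= r -> is_derive g x (g' x)) ->
  (forall x, Rabs x <= r -> Rabs (g' x) <= L) ->
  forall x, Rabs x <= r -> Rabs (g x - g 0) <= L * Rabs x.
Proof.
  intros hg hL x hx.
  assert (hin : forall y, Rmin 0 x <= y <= Rmax 0 x -> Rabs y <= Rabs x).
  { intros y hy. unfold Rmin, Rmax in hy. unfold Rabs. destruct (Rle_dec 0 x), (Rcase_abs y), (Rcase_abs x); lra. }
  destruct (MVT_gen g 0 x g') as (z & hz & e).
  - intros y hy. apply hg. apply Rle_trans with (Rabs x); [apply hin; lra | exact hx].
  - intros y hy. apply derivable_continuous_pt. exists (g' y). apply is_derive_Reals, hg.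
    apply Rle_trans with (Rabs x); [now apply hin | exact hx].
  - rewrite e, Rabs_mult, Rminus_0_r. apply Rmult_le_compat_r; [apply Rabs_pos|].
    apply hL. apply Rle_trans with (Rabs x); [now apply hin | exact hx].
Qed.

Lemma mvt_quadratic (g g' : R -> R) (a D r : R) :
  0 <= D ->
  (forall x, Rabs x <= r -> is_derive g x (g' x)) ->
  (forall x, Rabs x <= r -> Rabs (g' x - a) <= D * Rabs x) ->
  forall x, Rabs x <= r -> Rabs (g x - g 0 - a * x) <= D * x ^ 2.
Proof.
  intros hD hg hL x hx.
  pose proof (mvt_linear (fun t => g t - a * t) (fun t => g' t - a) (D * Rabs x) (Rabs x)) as h.
  replace (g x - g 0 - a * x) with (g x - a * x - (g 0 - a * 0)) by ring.
  replace (D * x ^ 2) with (D * Rabs x * Rabs x) by (rewrite <- (pow2_abs x); ring).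
  apply h; [| |lra].
  - intros y hy. apply @is_derive_minus; [apply hg; lra|]. auto_derive; [exact I|ring].
  - intros y hy. apply Rle_trans with (D * Rabs y); [apply hL; lra|].
    now apply Rmult_le_compat_l.
Qed.

Lemma sin_abs_le (x : R) : Rabs (sin x) <= Rabs x.
Proof.
  pose proof (fun a b => mvt_linear sin cos 1 (Rabs x) a b x) as h. rewrite sin_0, Rminus_0_r, Rmult_1_l in h.
  apply h; [| |lra].
  - intros y _. auto_derive; [exact I|ring].
  - intros y _. apply Rabs_le. apply COS_bound.
Qed.

Lemma one_minus_cos (x : R) : 0 <= 1 - cos x <= Rabs x.
Proof.
  assert (h := COS_bound x). split; [lra|].
  replace (cos x) with (cos (2 * (x / 2))) by (f_equal; field). rewrite cos_2a_sin.
  assert (h1 := sin_abs_le (x / 2)). assert (h2 := SIN_bound (x / 2)).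
  assert (h3 : Rabs (x / 2) = Rabs x / 2) by (unfold Rdiv; rewrite Rabs_mult, (Rabs_pos_eq (/ 2)); lra).
  rewrite h3 in h1. unfold Rabs at 1 in h1. destruct (Rcase_abs (sin (x / 2))); nra.
Qed.

Lemma sin_quadratic (x : R) : Rabs (sin x - x) <= x ^ 2.
Proof.
  pose proof (fun hD a b => mvt_quadratic sin cos 1 1 (Rabs x) hD a b x) as h. rewrite sin_0 in h.
  replace (sin x - x) with (sin x - 0 - 1 * x) by ring. rewrite <- (Rmult_1_l (x ^ 2)).
  apply h; [lra| | |lra].
  - intros y _. auto_derive; [exact I|ring].
  - intros y _. rewrite Rabs_minus_sym, Rmult_1_l. rewrite Rabs_pos_eq; apply one_minus_cos.
Qed.

Lemma tan_derive (x : R) : Rabs x <= PI / 4 -> is_derive tan x (1 + tan x ^ 2).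
Proof.
  intros hx. assert (hpi := PI_RGT_0). apply Rabs_le_between in hx.
  assert (hc : 0 < cos x) by (apply cos_pos; lra).
  unfold tan. auto_derive; [lra|]. field. lra.
Qed.

Lemma tan_abs_le_1 (x : R) : Rabs x <= PI / 4 -> Rabs (tan x) <= 1.
Proof.
  intros hx. assert (hpi := PI_RGT_0). apply Rabs_le_between in hx.
  rewrite <- tan_PI4. apply Rabs_le. rewrite <- tan_neg. split; apply tan_le; lra.
Qed.

Lemma tan_abs_le (x : R) : Rabs x <= PI / 4 -> Rabs (tan x) <= 2 * Rabs x.
Proof.
  intros hx. pose proof (fun a b => mvt_linear tan (fun y => 1 + tan y ^ 2) 2 (PI / 4) a b x) as h.
  rewrite tan_0, Rminus_0_r in h. apply h; [apply tan_derive| |exact hx].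
  intros y hy. assert (h1 := tan_abs_le_1 y hy). apply Rabs_le_between in h1.
  rewrite Rabs_pos_eq; nra.
Qed.

Lemma tan_quadratic (x : R) : Rabs x <= PI / 4 -> Rabs (tan x - x) <= 2 * x ^ 2.
Proof.
  intros hx. pose proof (fun hD a b => mvt_quadratic tan (fun y => 1 + tan y ^ 2) 1 2 (PI / 4) hD a b x) as h.
  rewrite tan_0 in h. replace (tan x - x) with (tan x - 0 - 1 * x) by ring.
  apply h; [lra|apply tan_derive| |exact hx].
  intros y hy. assert (h1 := tan_abs_le_1 y hy). assert (h2 := tan_abs_le y hy).
  replace (1 + tan y ^ 2 - 1) with (tan y ^ 2) by ring. rewrite <- (pow2_abs (tan y)).
  assert (h3 := Rabs_pos (tan y)). rewrite Rabs_pos_eq; nra.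
Qed.

Lemma ln_quadratic (x : R) : Rabs x <= 1 / 2 -> Rabs (ln (1 + x) - x) <= 2 * x ^ 2.
Proof.
  intros hx. pose proof (fun hD a b => mvt_quadratic (fun y => ln (1 + y)) (fun y => / (1 + y)) 1 2 (1 / 2) hD a b x) as h.
  simpl in h. rewrite Rplus_0_r, ln_1 in h. replace (ln (1 + x) - x) with (ln (1 + x) - 0 - 1 * x) by ring.
  simpl. apply h; [lra| | |exact hx]; intros y hy; apply Rabs_le_between in hy as hy'.
  - auto_derive; [lra|field; lra].
  - replace (/ (1 + y) - 1) with (- y * / (1 + y)) by (field; lra).
    rewrite Rabs_mult, Rabs_Ropp, Rmult_comm. apply Rmult_le_compat_r; [apply Rabs_pos|].
    rewrite Rabs_pos_eq; [|apply Rlt_le, Rinv_0_lt_compat; lra].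
    replace 2 with (/ (1 / 2)) by field. apply Rinv_le_contravar; lra.
Qed.

Lemma ln_tan_quadratic (x : R) :
  Rabs x <= PI / 6 -> Rabs (ln (tan (PI / 4 + x)) - 2 * x) <= 8 * x ^ 2.
Proof.
  intros hx. assert (hpi := PI_RGT_0).
  assert (hcos : forall y, Rabs y <= PI / 6 -> 1 / 2 <= cos (2 * y)).
  { intros y hy. apply Rabs_le_between in hy. rewrite <- cos_PI3.
    destruct (Rle_lt_dec 0 y); [apply cos_decr_1; lra|].
    rewrite <- (cos_neg (2 * y)). apply cos_decr_1; lra. }
  pose proof (fun hD a b => mvt_quadratic (fun y => ln (tan (PI / 4 + y))) (fun y => 2 / cos (2 * y)) 2 8 (PI / 6) hD a b x) as h.
  cbv beta in h. rewrite Rplus_0_r, tan_PI4, ln_1, Rminus_0_r in h.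
  apply h; [lra| | |exact hx]; intros y hy; specialize (hcos y hy); apply Rabs_le_between in hy as hy'.
  - assert (hs : 0 < sin (PI / 4 + y)) by (apply sin_gt_0; lra).
    assert (hc : 0 < cos (PI / 4 + y)) by (apply cos_pos; lra).
    assert (e : cos (2 * y) = 2 * sin (PI / 4 + y) * cos (PI / 4 + y)).
    { rewrite <- sin_2a. replace (2 * (PI / 4 + y)) with (PI / 2 + 2 * y) by field. now rewrite sin_plus, sin_PI2, cos_PI2, Rmult_1_l, Rmult_0_l, Rplus_0_r. }
    assert (h2 := sin2_cos2 (PI / 4 + y)). unfold Rsqr in h2.
    rewrite e. unfold tan. auto_derive.
    + repeat split; [lra|]. now apply Rdiv_lt_0_compat.
    + field_simplify_eq; [|repeat split; lra].
      set (S := sin (PI / 4 + y)) in *. set (C := cos (PI / 4 + y)) in *. lra.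
  - assert (h1 := one_minus_cos (2 * y)).
    replace (2 / cos (2 * y) - 2) with (2 * (1 - cos (2 * y)) * / cos (2 * y)) by (field; lra).
    rewrite Rabs_mult in h1. rewrite (Rabs_pos_eq 2) in h1 by lra.
    assert (h3 : 0 < / cos (2 * y) <= 2).
    { split; [apply Rinv_0_lt_compat; lra|]. apply Rle_trans with (/ (1 / 2)); [apply Rinv_le_contravar; lra | lra]. }
    rewrite Rabs_pos_eq by nra. nra.
Qed.

(** * Decay of the angles *)

Lemma sin_quarter (y : R) : 0 <= y <= PI / 2 -> y / 4 <= sin y.
Proof.
  intros hy. assert (hpi := PI_RGT_0). assert (hpi4 := PI_4).
  replace y with (2 * (y / 2)) at 2 by field. rewrite sin_2a.
  assert (hc : 1 / 2 <= cos (y / 2)) by (rewrite <- cos_PI3; apply cos_decr_1; lra).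
  assert (hs : y / 2 * (1 / 2) <= sin (y / 2)); [|nra].
  destruct (MVT_gen sin 0 (y / 2) cos) as (z & hz & e).
  - intros t _. auto_derive; [exact I|ring].
  - intros t _. apply continuity_sin.
  - rewrite Rmin_left, Rmax_right in hz by lra. rewrite sin_0 in e.
    assert (1 / 2 <= cos z) by (rewrite <- cos_PI3; apply cos_decr_1; lra).
    nra.
Qed.

(* Writing the equation as [sin 2x <= eta + cos 2x tan B] gives [sin (2x - B) <= eta]. *)
Lemma dP_contraction (c M x y z B : R) :
  0 < c <= 2 -> 0 < M -> Rabs x <= PI / 4 -> B <= PI / 4 ->
  Rabs x <= B -> Rabs y <= B -> Rabs z <= B -> dP M x y z = c - 1 ->
  Rabs x <= B / 2 + / M.
Proof.
  intros hc hM hx4 hB4 hx hy hz h. assert (hpi := PI_RGT_0).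
  assert (hB : 0 <= B) by (assert (h' := Rabs_pos x); lra).
  assert (hC : 0 <= cos (2 * x)) by (apply Rabs_le_between in hx4; apply cos_ge_0; lra).
  assert (ht : forall t, Rabs t <= B -> Rabs (tan ((x + t) / 2)) <= tan B).
  { intros t ht. apply Rabs_le_between in ht. apply Rabs_le_between in hx.
    apply Rabs_le. rewrite <- tan_neg. split; apply tan_le; lra. }
  assert (hS : Rabs (sin (2 * x)) * (2 * M + 1) <= 1 + cos (2 * x) * (2 * M + 1) * tan B).
  { unfold dP in h. assert (hy' := ht y hy). assert (hz' := ht z hz). clear ht.
    set (ty := tan ((x + y) / 2)) in *. set (tz := tan ((x + z) / 2)) in *.
    assert (hT : Rabs ((M + 1) * ty + M * tz) <= (2 * M + 1) * tan B).
    { eapply Rle_trans; [apply Rabs_triang|]. rewrite !Rabs_mult, (Rabs_pos_eq (M + 1)), (Rabs_pos_eq M) by lra. nra. }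
    replace (Rabs (sin (2 * x)) * (2 * M + 1)) with (Rabs ((c - 1) + cos (2 * x) * ((M + 1) * ty + M * tz))).
    2:{ rewrite <- h. rewrite <- (Rabs_pos_eq (2 * M + 1)) at 2 by lra. rewrite <- Rabs_mult. f_equal. ring. }
    eapply Rle_trans; [apply Rabs_triang|]. rewrite Rabs_mult, (Rabs_pos_eq (cos _)) by exact hC.
    assert (Rabs (c - 1) <= 1) by (apply Rabs_le; lra).
    assert (cos (2 * x) * Rabs ((M + 1) * ty + M * tz) <= cos (2 * x) * ((2 * M + 1) * tan B)) by nra.
    lra. }
  assert (hS' : sin (2 * Rabs x) * (2 * M + 1) <= 1 + cos (2 * Rabs x) * (2 * M + 1) * tan B).
  { unfold Rabs at 1 in hS. unfold Rabs.
    destruct (Rcase_abs (sin (2 * x))) as [h1|h1]; destruct (Rcase_abs x) as [h2|h2];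
    rewrite ?Ropp_mult_distr_r_reverse, ?sin_neg, ?cos_neg; try lra.
    - exfalso. assert (0 <= sin (2 * x)); [apply sin_ge_0|]; rewrite ?(Rabs_pos_eq x) in hx4; lra.
    - nra. }
  clear hS ht. set (X := Rabs x) in *. assert (hX : 0 <= X) by apply Rabs_pos.
  assert (hcB : 0 < cos B <= 1) by (split; [apply cos_pos; lra | apply COS_bound]).
  assert (hsin : sin (2 * X - B) * (2 * M + 1) <= 1).
  { rewrite sin_minus. unfold tan in hS'.
    apply (Rmult_le_compat_r (cos B)) in hS'; [|lra].
    replace ((1 + cos (2 * X) * (2 * M + 1) * (sin B / cos B)) * cos B)
      with (cos B + cos (2 * X) * (2 * M + 1) * sin B) in hS' by (field; lra). lra. }
  assert (hMi : 0 < / M) by now apply Rinv_0_lt_compat.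
  destruct (Rle_lt_dec (2 * X - B) 0) as [h0|h0]; [lra|].
  assert (hq := sin_quarter (2 * X - B) ltac:(lra)).
  assert (h2 : (2 * X - B) / 4 <= / (2 * M + 1)).
  { apply Rle_trans with (sin (2 * X - B)); [exact hq|].
    apply (Rmult_le_reg_r (2 * M + 1)); [lra|]. rewrite Rinv_l by lra. exact hsin. }
  assert (h3 : / (2 * M + 1) <= / (2 * M)) by (apply Rinv_le_contravar; lra).
  rewrite Rinv_mult in h3. lra.
Qed.

Lemma phi_abs_le (c : R) (phi : nat -> R) (k : nat) : diag_solution c phi -> Rabs (phi k) <= PI / 4.
Proof. intros [h _ _]. specialize (h k). apply Rabs_le. lra. Qed.

(** The bound [4/k] reproduces itself under the contraction: [2/k + 1/(k+1) <= 4/(k+1)] holds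
    exactly when [k >= 2], where the induction starts. *)
Lemma phi_decay (c : R) (phi : nat -> R) (k : nat) :
  0 < c <= 2 -> diag_solution c phi -> (1 <= k)%nat -> Rabs (phi k) <= 4 / INR k.
Proof.
  intros hc hphi hk. assert (hpi := PI_RGT_0). assert (hpi4 := PI_4).
  assert (h4 := fun k => phi_abs_le c phi k hphi).
  destruct (Nat.eq_dec k 1) as [->|hk1]; [specialize (h4 1%nat); simpl; lra|].
  apply (tail_bound (fun k => Rabs (phi k)) (fun k => 4 / INR k) 2); [| |lia].
  - intros j _. specialize (h4 j). simpl. lra.
  - clear k hk hk1. intros k j hk hj hall.
    assert (hkr : 2 <= INR k) by (apply (le_INR 2); exact hk).
    assert (hjr : INR k + 1 <= INR j) by (rewrite <- S_INR; apply le_INR; lia).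
    apply Rle_trans with (Rmin (4 / INR k) (PI / 4) / 2 + / INR j).
    + apply (dP_contraction c (INR j) (phi j) (phi (S j)) (phi (pred j))); auto; try lra; try apply Rmin_r.
      * apply Rmin_glb; [apply hall; lia | apply h4].
      * apply Rmin_glb; [apply hall; lia | apply h4].
      * apply Rmin_glb; [apply hall; lia | apply h4].
      * apply hphi.
    + assert (h1 := Rmin_l (4 / INR k) (PI / 4)). rewrite S_INR.
      assert (h2 : / INR j <= / (INR k + 1)) by (apply Rinv_le_contravar; lra).
      apply Rle_trans with (4 / INR k / 2 + / (INR k + 1)); [lra|].
      apply Rminus_le.
      replace (4 / INR k / 2 + / (INR k + 1) - 4 / (INR k + 1)) with ((2 - INR k) / (INR k * (INR k + 1))) by (field; lra).
      assert (0 < / (INR k * (INR k + 1))) by (apply Rinv_0_lt_compat; nra). unfold Rdiv. nra.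
Qed.
Lemma Rabs_le_mult (a b A B : R) : Rabs a <= A -> Rabs b <= B -> Rabs (a * b) <= A * B.
Proof. intros h1 h2. rewrite Rabs_mult. apply Rmult_le_compat; auto using Rabs_pos. Qed.

Lemma sqr_le (a A : R) : Rabs a <= A -> a ^ 2 <= A ^ 2.
Proof. intros h. rewrite <- (pow2_abs a). apply pow_incr. split; [apply Rabs_pos | exact h]. Qed.

(* The linearisation of [dP] at [0] is [(2M+1) (3/2) x - (M+1)/2 y - M/2 z], and it maps [k |-> (c-1)/(2k+1)] to
   [c - 1 + O(1/M)]. *)
Lemma dP_linearized (c M x y z B : R) :
  0 < c <= 2 -> 2 <= M ->
  Rabs x <= 8 / M -> Rabs y <= 8 / M -> Rabs z <= 8 / M ->
  Rabs x <= PI / 4 -> Rabs y <= PI / 4 -> Rabs z <= PI / 4 ->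
  dP M x y z = c - 1 ->
  Rabs (y - (c - 1) / (2 * M + 3)) <= B -> Rabs (z - (c - 1) / (2 * M - 1)) <= B ->
  Rabs (x - (c - 1) / (2 * M + 1)) <= B / 3 + 1000 / M ^ 2.
Proof.
  intros hc hM hx hy hz hx4 hy4 hz4 h hpy hpz.
  set (w := / M). assert (hw : 0 < w) by (apply Rinv_0_lt_compat; lra).
  assert (hMw : M * w = 1) by (unfold w; field; lra).
  assert (hw2 : w <= / 2) by (apply Rinv_le_contravar; lra).
  unfold Rdiv in hx, hy, hz. fold w in hx, hy, hz.
  assert (hs : forall t, Rabs t <= 8 * w -> Rabs ((x + t) / 2) <= 8 * w).
  { intros t ht. apply Rabs_le_between in ht. apply Rabs_le_between in hx. apply Rabs_le. lra. }
  assert (hs4 : forall t, Rabs t <= PI / 4 -> Rabs ((x + t) / 2) <= PI / 4).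
  { intros t ht. apply Rabs_le_between in ht. apply Rabs_le_between in hx4. apply Rabs_le. lra. }
  assert (hsy := hs y hy). assert (hsz := hs z hz). assert (hsy4 := hs4 y hy4). assert (hsz4 := hs4 z hz4).
  assert (ty := tan_quadratic _ hsy4). assert (tz := tan_quadratic _ hsz4).
  assert (uy := tan_abs_le _ hsy4). assert (uz := tan_abs_le _ hsz4).
  assert (qy := sqr_le _ _ hsy). assert (qz := sqr_le _ _ hsz).
  assert (h2x : Rabs (2 * x) <= 16 * w) by (apply Rabs_le_between in hx; apply Rabs_le; lra).
  assert (sx := sin_quadratic (2 * x)). assert (q2x := sqr_le _ _ h2x).
  assert (cx := one_minus_cos (2 * x)).
  unfold dP in h.
  set (e1 := sin (2 * x) - 2 * x) in *. set (e2 := tan ((x + y) / 2) - (x + y) / 2) in *.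
  set (e3 := tan ((x + z) / 2) - (x + z) / 2) in *. set (e0 := 1 - cos (2 * x)) in *.
  set (Y := tan ((x + y) / 2)) in *. set (Z := tan ((x + z) / 2)) in *.
  (* The defect of [(c-1)/(2M+1)] as a solution of the linearised equation. *)
  set (ev := (c - 1) * (/ (2 * M - 1) - / (2 * M + 3)) / 4).
  assert (e : (2 * M + 1) * (3 / 2) * (x - (c - 1) / (2 * M + 1))
     = (M + 1) / 2 * (y - (c - 1) / (2 * M + 3)) + M / 2 * (z - (c - 1) / (2 * M - 1))
       + (- ((2 * M + 1) * e1) + (M + 1) * e2 + M * e3 + - (e0 * ((M + 1) * Y + M * Z)) + ev)).
  { transitivity ((2 * M + 1) * (3 / 2) * x - 3 / 2 * (c - 1)); [field; lra|].
    unfold ev. rewrite <- h. unfold e1, e2, e3, e0. fold Y Z. field. lra. }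
  assert (b1 : Rabs e1 <= 256 * w ^ 2) by lra.
  assert (b2 : Rabs e2 <= 128 * w ^ 2) by lra.
  assert (b3 : Rabs e3 <= 128 * w ^ 2) by lra.
  assert (b0 : Rabs e0 <= 16 * w) by (rewrite Rabs_pos_eq; lra).
  assert (bv : Rabs ev <= w).
  { unfold ev. replace ((c - 1) * (/ (2 * M - 1) - / (2 * M + 3)) / 4)
      with ((c - 1) * ((/ (2 * M - 1) - / (2 * M + 3)) / 4)) by (field; lra).
    assert (i1 : / (2 * M - 1) <= w) by (apply Rinv_le_contravar; lra).
    assert (i2 : 0 < / (2 * M + 3)) by (apply Rinv_0_lt_compat; lra).
    assert (i3 : / (2 * M + 3) <= / (2 * M - 1)) by (apply Rinv_le_contravar; lra).
    apply Rle_trans with (1 * w); [|lra]. apply Rabs_le_mult; apply Rabs_le; lra. }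
  assert (bT : Rabs ((M + 1) * Y + M * Z) <= 48).
  { eapply Rle_trans; [apply Rabs_triang|]. rewrite !Rabs_mult, (Rabs_pos_eq (M + 1)), (Rabs_pos_eq M) by lra. nra. }
  assert (b4 := Rabs_le_mult _ _ _ _ b0 bT).
  assert (bM1 : Rabs (2 * M + 1) <= 3 * M) by (rewrite Rabs_pos_eq; lra).
  assert (bM2 : Rabs (M + 1) <= 2 * M) by (rewrite Rabs_pos_eq; lra).
  assert (bM3 : Rabs M <= M) by (rewrite Rabs_pos_eq; lra).
  assert (b5 := Rabs_le_mult _ _ _ _ bM1 b1). assert (b6 := Rabs_le_mult _ _ _ _ bM2 b2).
  assert (b7 := Rabs_le_mult _ _ _ _ bM3 b3).
  replace (3 * M * (256 * w ^ 2)) with (768 * w * (M * w)) in b5 by ring.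
  replace (2 * M * (128 * w ^ 2)) with (256 * w * (M * w)) in b6 by ring.
  replace (M * (128 * w ^ 2)) with (128 * w * (M * w)) in b7 by ring.
  rewrite hMw in b5, b6, b7.
  set (py := y - (c - 1) / (2 * M + 3)) in *. set (pz := z - (c - 1) / (2 * M - 1)) in *.
  set (px := x - (c - 1) / (2 * M + 1)) in *.
  (* The five bounds add up to [768 + 256 + 128 + 768 + 1] times [w]. *)
  assert (hE : Rabs (- ((2 * M + 1) * e1) + (M + 1) * e2 + M * e3 + - (e0 * ((M + 1) * Y + M * Z)) + ev) <= 2000 * w).
  { set (a1 := (2 * M + 1) * e1) in *. set (a2 := (M + 1) * e2) in *. set (a3 := M * e3) in *.
    set (a4 := e0 * ((M + 1) * Y + M * Z)) in *.
    apply Rabs_le_between in b5. apply Rabs_le_between in b6. apply Rabs_le_between in b7.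
    apply Rabs_le_between in b4. apply Rabs_le_between in bv. apply Rabs_le. lra. }
  assert (hp : (2 * M + 1) * (3 / 2) * Rabs px <= (2 * M + 1) / 2 * B + 2000 * w).
  { rewrite <- (Rabs_pos_eq ((2 * M + 1) * (3 / 2))) by lra. rewrite <- Rabs_mult, e.
    eapply Rle_trans; [apply Rabs_triang|]. apply Rplus_le_compat; [|exact hE].
    eapply Rle_trans; [apply Rabs_triang|].
    rewrite !Rabs_mult, (Rabs_pos_eq ((M + 1) / 2)), (Rabs_pos_eq (M / 2)) by lra. nra. }
  replace (1000 / M ^ 2) with (1000 * w ^ 2) by (unfold w; field; lra).
  apply (Rmult_le_reg_l ((2 * M + 1) * (3 / 2))); [lra|].
  eapply Rle_trans; [exact hp|].
  replace ((2 * M + 1) * (3 / 2) * (B / 3 + 1000 * w ^ 2))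
    with ((2 * M + 1) / 2 * B + (3000 * w * (M * w) + 1500 * w ^ 2)) by field.
  rewrite hMw. nra.
Qed.

(** The constants reproduce themselves: [4000/(3 k^2) + 1000/(k+1)^2 <= 4000/(k+1)^2] amounts to
    [2(k+1) <= 3k], true from [k = 2] on. *)
Lemma phi_second_order (c : R) (phi : nat -> R) (k : nat) :
  0 < c <= 2 -> diag_solution c phi -> (2 <= k)%nat ->
  Rabs (phi k - (c - 1) / (2 * INR k + 1)) <= 4000 / INR k ^ 2.
Proof.
  intros hc hphi hk. assert (hpi := PI_RGT_0). assert (hpi4 := PI_4).
  assert (h4 := fun k => phi_abs_le c phi k hphi).
  apply (tail_bound (fun k => Rabs (phi k - (c - 1) / (2 * INR k + 1))) (fun k => 4000 / INR k ^ 2) 2); [| |exact hk].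
  - intros j hj. specialize (h4 j).
    assert (hjr : 2 <= INR j) by (apply (le_INR 2); exact hj).
    assert (hi : 0 < / (2 * INR j + 1) <= 1).
    { split; [apply Rinv_0_lt_compat; lra|]. rewrite <- Rinv_1. apply Rinv_le_contravar; lra. }
    apply Rle_trans with 2; [|simpl; lra].
    apply Rabs_le_between in h4. unfold Rdiv. apply Rabs_le. nra.
  - clear k hk. intros k j hk hj hall.
    assert (hkr : 2 <= INR k) by (apply (le_INR 2); exact hk).
    assert (hjr : INR k + 1 <= INR j) by (rewrite <- S_INR; apply le_INR; lia).
    assert (hpj : INR (pred j) = INR j - 1).
    { destruct j as [|j]; [lia|]. rewrite S_INR. simpl pred. ring. }
    (* The constant doubles from 4 to 8 to cover the neighbour [pred j]: [4/(j-1) <= 8/j]. *)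
    assert (hsmall : forall i, (pred j <= i)%nat -> Rabs (phi i) <= 8 / INR j).
    { intros i hi. eapply Rle_trans; [apply (phi_decay c); auto; lia|].
      apply le_INR in hi. rewrite hpj in hi.
      apply (Rmult_le_reg_r (INR i * INR j)); [nra|]. field_simplify; [|lra|lra]. nra. }
    apply Rle_trans with (4000 / INR k ^ 2 / 3 + 1000 / INR j ^ 2).
    + apply (dP_linearized c (INR j) (phi j) (phi (S j)) (phi (pred j))); auto; try lra; try (apply hsmall; lia).
      * apply hphi.
      * replace (2 * INR j + 3) with (2 * INR (S j) + 1) by (rewrite S_INR; ring). apply hall. lia.
      * replace (2 * INR j - 1) with (2 * INR (pred j) + 1) by (rewrite hpj; ring). apply hall. lia.
    + rewrite S_INR.
      assert (h1 : 1000 / INR j ^ 2 <= 1000 / (INR k + 1) ^ 2).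
      { apply Rmult_le_compat_l; [lra|]. apply Rinv_le_contravar; [nra|]. apply pow_incr. lra. }
      eapply Rle_trans; [apply Rplus_le_compat_l, h1|].
      apply Rminus_le.
      replace (4000 / INR k ^ 2 / 3 + 1000 / (INR k + 1) ^ 2 - 4000 / (INR k + 1) ^ 2)
        with (1000 / 3 * (4 * (INR k + 1) ^ 2 - 9 * INR k ^ 2) * / (INR k ^ 2 * (INR k + 1) ^ 2)) by (field; lra).
      assert (0 < / (INR k ^ 2 * (INR k + 1) ^ 2)).
      { apply Rinv_0_lt_compat. apply Rmult_lt_0_compat; apply pow_lt; lra. }
      assert (4 * (INR k + 1) ^ 2 - 9 * INR k ^ 2 <= 0) by nra. nra.
Qed.

(** * Asymptotics of the diagonal radii *)

(** Since [1/k^2 <= 2/k - 2/(k+1)], [L k - 2C/k] increases, [L k + 2C/k] decreases, and the second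
    bounds the first. *)
Lemma increments_converge (L : nat -> R) (C : R) (K : nat) :
  0 <= C -> (1 <= K)%nat ->
  (forall k, (K <= k)%nat -> Rabs (L (S k) - L k) <= C / INR k ^ 2) ->
  exists l : R, is_lim_seq L l.
Proof.
  intros hC hK h.
  pose (P := fun k => L (k + K)%nat - 2 * C / INR (k + K)). pose (Q := fun k => L (k + K)%nat + 2 * C / INR (k + K)).
  assert (hk : forall k, 1 <= INR (k + K)) by (intros k; apply (le_INR 1); lia).
  assert (hstep : forall k, Rabs (L (S (k + K)) - L (k + K)%nat) <= 2 * C / INR (k + K) - 2 * C / INR (S (k + K))).
  { intros k. eapply Rle_trans; [apply h; lia|]. specialize (hk k). rewrite S_INR.
    set (r := INR (k + K)) in *. apply Rminus_le.
    replace (C / r ^ 2 - (2 * C / r - 2 * C / (r + 1))) with (C * (1 - r) * / (r ^ 2 * (r + 1))) by (field; lra).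
    assert (0 < / (r ^ 2 * (r + 1))) by (apply Rinv_0_lt_compat, Rmult_lt_0_compat; [apply pow_lt|]; lra).
    assert (C * (1 - r) <= 0) by nra. nra. }
  assert (hP : forall k, P k <= P (S k)).
  { intros k. unfold P. specialize (hstep k). apply Rabs_le_between in hstep. simpl (S k + K)%nat. lra. }
  assert (hQ : forall k, Q (S k) <= Q k).
  { intros k. unfold Q. specialize (hstep k). apply Rabs_le_between in hstep. simpl (S k + K)%nat. lra. }
  assert (hQ0 : forall k, Q k <= Q 0%nat).
  { induction k as [|k IH]; [lra|]. specialize (hQ k). lra. }
  destruct (ex_finite_lim_seq_incr P (Q 0%nat)) as [l hl].
  - exact hP.
  - intros k. specialize (hQ0 k). apply Rle_trans with (Q k); [|exact hQ0]. unfold P, Q.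
    specialize (hk k). assert (0 <= 2 * C / INR (k + K)); [|lra]. apply Rdiv_le_0_compat; lra.
  - exists l. apply (is_lim_seq_incr_n L K).
    apply (is_lim_seq_ext (fun k => P k + 2 * C * / INR (k + K))).
    { intros k. unfold P, Rdiv. ring. }
    replace (Finite l) with (Finite (l + 2 * C * 0)) by (f_equal; ring).
    apply is_lim_seq_plus'; [exact hl|].
    apply (is_lim_seq_scal_l (fun k => / INR (k + K)) (2 * C) 0).
    apply (is_lim_seq_incr_n (fun k => / INR k) K), is_lim_seq_inv_INR.
Qed.

Lemma phi_lim (c : R) (phi : nat -> R) : 0 < c <= 2 -> diag_solution c phi -> is_lim_seq phi 0.
Proof.
  intros hc hphi. apply is_lim_seq_abs_0.
  apply (is_lim_seq_le_le_loc (fun _ => 0) _ (fun k => 4 * / INR k)).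
  - exists 1%nat. intros k hk. split; [apply Rabs_pos | now apply (phi_decay c)].
  - apply is_lim_seq_const.
  - replace (Finite 0) with (Finite (4 * 0)) by (f_equal; ring).
    apply (is_lim_seq_scal_l (fun n => / INR n) 4 0), is_lim_seq_inv_INR.
Qed.

Lemma tan_lim (u : nat -> R) : is_lim_seq u 0 -> is_lim_seq (fun k => tan (PI / 4 + u k)) 1.
Proof.
  intros hu. rewrite <- tan_PI4.
  apply (is_lim_seq_continuous tan (fun k => PI / 4 + u k) (PI / 4)).
  - assert (h := PI_RGT_0). apply derivable_continuous_pt. exists (1 + tan (PI / 4) ^ 2).
    apply is_derive_Reals, tan_derive. rewrite Rabs_pos_eq; lra.
  - replace (Finite (PI / 4)) with (Finite (PI / 4 + 0)) by (f_equal; ring).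
    apply is_lim_seq_plus'; [apply is_lim_seq_const | exact hu].
Qed.

Lemma diag_ratio_lim (c : R) (phi : nat -> R) :
  0 < c <= 2 -> diag_solution c phi ->
  is_lim_seq (fun k => diag_radius phi (S k) / diag_radius phi k) 1.
Proof.
  intros hc hphi. apply (is_lim_seq_ext_loc (fun k => tan (PI / 4 + phi k))).
  - exists 1%nat. intros [|k] hk; [lia|]. assert (h := diag_radius_pos c phi k hphi).
    rewrite diag_radius_SS. field. lra.
  - apply tan_lim. now apply (phi_lim c).
Qed.

Lemma side_ratio_lim (c : R) (phi : nat -> R) :
  0 < c <= 2 -> diag_solution c phi ->
  is_lim_seq (fun k => side_radius phi (S k) / diag_radius phi (S k)) 1.
Proof.
  intros hc hphi. apply (is_lim_seq_ext (fun k => tan (PI / 4 + (phi k - phi (S k)) / 2))).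
  - intros k. assert (h := diag_radius_pos c phi k hphi). unfold side_radius. simpl pred. field. lra.
  - assert (h := phi_lim c phi hc hphi). assert (h' := proj1 (is_lim_seq_incr_1 phi 0) h).
    apply tan_lim. replace (Finite 0) with (Finite ((0 - 0) * / 2)) by (f_equal; field).
    apply (is_lim_seq_mult' _ (fun _ => / 2)); [|apply is_lim_seq_const].
    now apply is_lim_seq_minus'.
Qed.

(** The increments of [ln (diag_radius phi k) - (c - 1) ln k] are [2 phi k - (c-1)/k + O(1/k^2)],
    and the leading term of [phi k] cancels [(c-1)/k]. Passing through logarithms makes the limit
    positive. *)
Lemma diag_asymptotics (c : R) (phi : nat -> R) :
  0 < c <= 2 -> diag_solution c phi ->
  exists K, 0 < K /\ is_lim_seq (fun k => diag_radius phi k / Rpower (INR k) (c - 1)) K.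
Proof.
  intros hc hphi. assert (hpi := PI_RGT_0). assert (hpi3 := PI2_3_2).
  pose (L := fun k => ln (diag_radius phi k) - (c - 1) * ln (INR k)).
  (* From 8 on, [|phi k| <= 4/k <= 1/2 < PI/6], as [ln_tan_quadratic] requires. The constant exceeds
     [8 * 4^2 + 2 * 4000 + 1 + 2]. *)
  destruct (increments_converge L 9000 8) as [l hl]; [lra|lia| |].
  - intros k hk. unfold L.
    assert (hkr : 8 <= INR k) by (apply (le_INR 8) in hk; simpl in hk; lra).
    destruct k as [|k]; [lia|]. assert (hs := diag_radius_pos c phi k hphi).
    rewrite diag_radius_SS. assert (hr := sol_range c phi hphi (S k)). assert (hr' := sol_range_S c phi hphi k).
    rewrite ln_mult by (try apply tan_pos; lra). rewrite (S_INR (S k)).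
    assert (hd := phi_decay c phi (S k) hc hphi ltac:(lia)).
    assert (h2 := phi_second_order c phi (S k) hc hphi ltac:(lia)).
    set (r := INR (S k)) in *. set (x := phi (S k)) in *.
    set (w := / r). assert (hw : 0 < w) by (apply Rinv_0_lt_compat; lra).
    assert (hw8 : w <= / 8) by (apply Rinv_le_contravar; lra).
    unfold Rdiv in hd. fold w in hd.
    assert (q := ln_tan_quadratic x ltac:(lra)).
    replace (r + 1) with (r * (1 + w)) by (unfold w; field; lra). rewrite ln_mult by lra.
    assert (q' := ln_quadratic w ltac:(rewrite Rabs_pos_eq; lra)).
    assert (qx := sqr_le _ _ hd).
    replace (9000 / r ^ 2) with (9000 * w ^ 2) by (unfold w; field; lra).
    replace (4000 / r ^ 2) with (4000 * w ^ 2) in h2 by (unfold w; field; lra).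
    assert (h3 : Rabs (2 * ((c - 1) / (2 * r + 1)) - (c - 1) * w) <= w ^ 2).
    { replace (2 * ((c - 1) / (2 * r + 1)) - (c - 1) * w) with ((c - 1) * (- (w * / (2 * r + 1)))) by (unfold w; field; lra).
      assert (/ (2 * r + 1) <= w) by (apply Rinv_le_contravar; lra).
      assert (0 < / (2 * r + 1)) by (apply Rinv_0_lt_compat; lra).
      replace (w ^ 2) with (1 * (w * w)) by ring. apply Rabs_le_mult; apply Rabs_le; [lra|]. nra. }
    assert (h4 : Rabs ((c - 1) * (ln (1 + w) - w)) <= 1 * (2 * w ^ 2)).
    { apply Rabs_le_mult; [apply Rabs_le; lra | exact q']. }
    apply Rabs_le_between in h4. apply Rabs_le_between in h3. apply Rabs_le_between in h2. apply Rabs_le_between in q.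
    apply Rabs_le. lra.
  - exists (exp l). split; [apply exp_pos|].
    apply (is_lim_seq_ext_loc (fun k => exp (L k))).
    + exists 1%nat. intros [|k] hk; [lia|]. assert (hs := diag_radius_pos c phi k hphi).
      unfold L, Rpower. unfold Rminus at 1. rewrite exp_plus, exp_Ropp, exp_ln by exact hs. reflexivity.
    + apply (is_lim_seq_continuous exp); [|exact hl].
      apply derivable_continuous_pt, derivable_pt_exp.
Qed.

(** * Neighbouring columns *)

(** The bound is uniform in [n] and [m], which both grow along a column, so the reflection factor
    tends to 1 with [rho]. *)
Lemma reflect_ratio_bound (n m rho : R) :
  0 < n -> 0 <= m <= n -> 0 < rho -> Rabs ((n * rho + m) / (n + m * rho) - 1) <= Rabs (rho - 1).
Proof.
  intros hn hm hr.
  replace ((n * rho + m) / (n + m * rho) - 1) with ((rho - 1) * ((n - m) / (n + m * rho))) by (field; nra).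
  rewrite <- (Rmult_1_r (Rabs (rho - 1))). rewrite Rabs_mult. apply Rmult_le_compat_l; [apply Rabs_pos|].
  assert (0 < n + m * rho) by nra.
  rewrite Rabs_pos_eq; [apply Rle_div_l; nra | apply Rdiv_le_0_compat; lra].
Qed.

Lemma shifted_ratio_lim (s r : nat -> R) :
  (forall k, 0 < s (S k)) -> (forall k, 0 < r (S k)) ->
  is_lim_seq (fun k => s (S k) / s k) 1 -> is_lim_seq (fun k => r k / s k) 1 ->
  is_lim_seq (fun k => r (S k) / r k) 1.
Proof.
  intros hs hr h1 h2.
  assert (h3 := proj1 (is_lim_seq_incr_1 (fun k => r k / s k) 1) h2).
  apply (is_lim_seq_ext_loc (fun k => (r (S k) / s (S k)) * (s (S k) / s k) / (r k / s k))).
  - exists 1%nat. intros [|k] hk; [lia|]. assert (a := hs k). assert (b := hs (S k)). assert (d := hr k). field. lra.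
  - apply is_lim_seq_div1; [|exact h2]. now apply is_lim_seq_mult1.
Qed.

Lemma column_ratio_lim (c : R) (phi : nat -> R) (N : nat) :
  0 < c <= 2 -> diag_solution c phi ->
  is_lim_seq (fun k => column (diag_radius phi) (side_radius phi) N k / diag_radius phi k) 1.
Proof.
  intros hc hphi. set (s := diag_radius phi). set (q := side_radius phi).
  assert (hd : diagonal c s q) by (now apply diag_solution_diagonal).
  assert (hs : forall k, 0 < s (S k)) by (intros k; now apply (diag_radius_pos c)).
  assert (hr : is_lim_seq (fun k => s (S k) / s k) 1) by now apply (diag_ratio_lim c).
  assert (hpos : forall N k, 0 < column s q N (S k)) by (intros; apply (column_pos c); auto; lia).
  assert (h : is_lim_seq (fun k => column s q N k / s k) 1 /\ is_lim_seq (fun k => column s q (S N) k / s k) 1);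
    [|apply h].
  induction N as [|N [IH1 IH2]].
  - split.
    + apply (is_lim_seq_ext_loc (fun _ => 1)); [|apply is_lim_seq_const].
      exists 1%nat. intros [|k] hk; [lia|]. change (column s q 0) with s. specialize (hs k). field. lra.
    + apply (is_lim_seq_ext_loc (fun k => (q (S k) / s (S k)) * (s (S k) / s k))).
      * exists 1%nat. intros [|k] hk; [lia|]. change (column s q 1 (S k)) with (q (S (S k))).
        assert (a := hs k). assert (b := hs (S k)). field. lra.
      * apply is_lim_seq_mult1; [now apply (side_ratio_lim c) | exact hr].
  - split; [exact IH2|].
    set (l := column s q N) in *. set (r := column s q (S N)) in *.
    assert (hl1 := shifted_ratio_lim s l hs (hpos N) hr IH1).
    assert (hr1 := shifted_ratio_lim s r hs (hpos (S N)) hr IH2).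
    assert (hr2 : is_lim_seq (fun k => r (S (S k)) / r k) 1).
    { apply (is_lim_seq_ext (fun k => (r (S (S k)) / r (S k)) * (r (S k) / r k))).
      - intros [|k].
        + assert (0 < r 0%nat) by (apply (column_pos c); auto; lia). assert (a := hpos (S N) 0%nat). fold r in a. field. lra.
        + assert (a := hpos (S N) (S k)). assert (b := hpos (S N) k). fold r in a, b. field. lra.
      - apply is_lim_seq_mult1; [|exact hr1]. now apply (is_lim_seq_incr_1 (fun k => r (S k) / r k)). }
    pose (n := fun k => 2 * INR N + INR k + 3). pose (m := fun k => INR k + 1).
    pose (rho := fun k => r (S (S k)) / r k).
    assert (hrpos : forall k, 0 < r k) by (intros k; apply (column_pos c); auto; lia).
    assert (hb : is_lim_seq (fun k => (n k * rho k + m k) / (n k + m k * rho k)) 1).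
    { apply (is_lim_seq_ext (fun k => 1 + ((n k * rho k + m k) / (n k + m k * rho k) - 1))); [intros; ring|].
      replace (Finite 1) with (Finite (1 + 0)) by (f_equal; ring).
      apply is_lim_seq_plus'; [apply is_lim_seq_const|]. apply is_lim_seq_abs_0.
      apply (is_lim_seq_le_le (fun _ => 0) _ (fun k => Rabs (rho k - 1))).
      - intros k. split; [apply Rabs_pos|]. assert (hN := pos_INR N). assert (hk := pos_INR k).
        apply reflect_ratio_bound; unfold n, m; try lra. apply Rdiv_lt_0_compat; apply hrpos.
      - apply is_lim_seq_const.
      - apply (proj1 (is_lim_seq_abs_0 (fun k => rho k - 1))).
        replace (Finite 0) with (Finite (1 - 1)) by (f_equal; ring).
        apply is_lim_seq_minus'; [exact hr2 | apply is_lim_seq_const]. }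
    apply (is_lim_seq_ext_loc (fun k => (l (S (S k)) / l (S k)) * (l (S k) / l k) * (l k / s k)
       * ((n k * rho k + m k) / (n k + m k * rho k)))).
    + exists 1%nat. intros [|k] hk; [lia|]. rewrite column_SS. fold l r.
      assert (hN := pos_INR N). assert (hk' := pos_INR (S k)).
      assert (a1 := hpos N k). assert (a2 := hpos N (S k)). fold l in a1, a2.
      assert (b1 := hrpos (S k)). assert (b2 := hrpos (S (S (S k)))). assert (d1 := hs k).
      unfold rho, n, m. field. repeat split; try lra; nra.
    + apply is_lim_seq_mult1; [|exact hb]. apply is_lim_seq_mult1; [|exact IH1].
      apply is_lim_seq_mult1; [|exact hl1]. now apply (is_lim_seq_incr_1 (fun k => l (S k) / l k)).
Qed.

Lemma pattern_asymptotics (c la : R) (phi : nat -> R) (u : C) (f : nat -> nat -> C) :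
  0 < c <= 2 -> 0 < la -> diag_solution c phi -> Cmod u = 1 ->
  (forall n m, h_edge f la (grid (diag_radius phi) (side_radius phi))
     (frame (grid (diag_radius phi) (side_radius phi)) u) n m) ->
  exists K, 0 < K /\ forall N0 : Z,
    is_lim_seq (fun M : nat => radius f N0 M / (K * Rpower (INR M) (c - 1))) 1.
Proof.
  intros hc hla hphi hu hf. destruct (diag_asymptotics c phi hc hphi) as (K & hK & hlim).
  exists (la * K). split; [now apply Rmult_lt_0_compat|]. intros N0.
  set (N := Z.abs_nat N0). set (s := diag_radius phi) in *.
  assert (hs : forall k, 0 < s (S k)) by (intros k; now apply (diag_radius_pos c)).
  apply (is_lim_seq_incr_n _ N).
  apply (is_lim_seq_ext (fun k => column s (side_radius phi) N k / (K * Rpower (INR (k + N)) (c - 1)))).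
  { intros k. unfold N. rewrite (pattern_radius c la s (side_radius phi) u f N0 k); auto.
    - assert (0 < Rpower (INR (k + Z.abs_nat N0)) (c - 1)) by apply exp_pos. field. lra.
    - now apply diag_solution_diagonal. }
  assert (hr : is_lim_seq (fun k => s (k + N)%nat / s k) 1).
  { generalize N as j. induction j as [|j IH].
    - apply (is_lim_seq_ext_loc (fun _ => 1)); [|apply is_lim_seq_const].
      exists 1%nat. intros [|k] hk; [lia|]. rewrite Nat.add_0_r. specialize (hs k). field. lra.
    - assert (h := proj1 (is_lim_seq_incr_n (fun k => s (S k) / s k) j 1) (diag_ratio_lim c phi hc hphi)).
      apply (is_lim_seq_ext_loc (fun k => s (S (k + j)) / s (k + j)%nat * (s (k + j)%nat / s k))).
      + exists 1%nat. intros [|k] hk; [lia|]. rewrite Nat.add_succ_r. simpl (S k + j)%nat.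
        assert (a := hs k). assert (b := hs (k + j)%nat). field. lra.
      + now apply is_lim_seq_mult1. }
  assert (hc1 := column_ratio_lim c phi N hc hphi). fold s in hc1.
  assert (hk := proj1 (is_lim_seq_incr_n _ N K) hlim). cbv beta in hk.
  apply (is_lim_seq_ext_loc (fun k => column s (side_radius phi) N k / s k / (s (k + N)%nat / s k)
     * (s (k + N)%nat / Rpower (INR (k + N)) (c - 1) / K))).
  - exists 1%nat. intros [|k] hk0; [lia|].
    assert (0 < Rpower (INR (S k + N)) (c - 1)) by apply exp_pos.
    assert (a := hs k). assert (b := hs (k + N)%nat). simpl (S k + N)%nat in *. field. lra.
  - apply is_lim_seq_mult1; [now apply is_lim_seq_div1|].
    replace (Finite 1) with (Finite (K / K)) by (f_equal; field; lra).
    apply is_lim_seq_div'; [exact hk | apply is_lim_seq_const | lra].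
Qed.

(** * The maps Z^c and Z^2 *)

Lemma closure_of_tan (s0 s1 t : R) :
  s0 * sin t = s1 * cos t ->
  ((s0, s1) : C) = ((cos (2 * t), sin (2 * t)) * (s0, (- s1)%R))%C.
Proof.
  intros h. assert (h1 := sin2_cos2 t). unfold Rsqr in h1.
  rewrite cos_2a_sin, sin_2a. unfold Cmult; simpl. f_equal.
  - transitivity (s0 - 2 * sin t * (s0 * sin t - s1 * cos t)); [rewrite h|]; ring.
  - transitivity (s1 * (sin t * sin t + cos t * cos t) + (s0 * sin t - s1 * cos t) * cos t); [rewrite h, h1; ring|].
    transitivity (2 * sin t * cos t * s0 - (cos t * cos t - sin t * sin t) * s1
      - (s0 * sin t - s1 * cos t) * cos t); [ring|].
    replace (cos t * cos t - sin t * sin t) with (1 - 2 * sin t * sin t) by lra. rewrite h. ring.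
Qed.

Lemma Cmod_cos_sin (t : R) : Cmod (cos t, sin t) = 1.
Proof.
  unfold Cmod. simpl. transitivity (sqrt 1); [f_equal | apply sqrt_1].
  assert (h := sin2_cos2 t). unfold Rsqr in h. lra.
Qed.

Lemma Zc_asymptotics (c : R) (f : nat -> nat -> C) :
  0 < c < 2 -> is_Zc c f ->
  exists K, 0 < K /\ forall N0 : Z,
    is_lim_seq (fun M : nat => radius f N0 M / (K * Rpower (INR M) (c - 1))) 1.
Proof.
  intros hc (hcr & hco & h00 & h10 & h01). assert (hpi := PI_RGT_0).
  destruct (diag_solution_exists c ltac:(lra)) as [phi hphi].
  assert (hd := diag_solution_diagonal c phi hphi).
  set (s := diag_radius phi) in *. set (q := side_radius phi) in *.
  assert (hq : 0 < q 1%nat) by now apply (side_radius_pos c).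
  assert (hs1 : s 1%nat = 1) by reflexivity.
  assert (h0 : (2 - c) * q 1%nat = c * s 0%nat).
  { destruct hd as (_ & _ & _ & h & _). simpl INR in h. lra. }
  assert (hs0 : 0 < s 0%nat) by nra.
  assert (hb := boundary_value c s q ltac:(lra) hd).
  assert (hI0 := cos_moment_0 (c / 2) ltac:(lra)). assert (hI1 := cos_moment_1 (c / 2)).
  replace (c / 2 * (PI / 2)) with (c * PI / 4) in * by field.
  (* The corner equation [h0] supplies the factor [1 - c/2] that completes [1 + c/2] to the
     coefficient [1 - (c/2)^2] of [cos_moment_1]. *)
  assert (ht : s 0%nat * sin (c * PI / 4) = s 1%nat * cos (c * PI / 4)).
  { rewrite <- hI0, <- hI1.
    replace (s 0%nat) with ((2 - c) * q 1%nat / c) by (rewrite h0; field; lra).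
    replace ((2 - c) * q 1%nat / c * (c / 2 * cos_moment (c / 2) 0))
      with ((1 - c / 2) * (q 1%nat * cos_moment (c / 2) 0)) by (field; lra).
    rewrite <- hb. ring. }
  apply closure_of_tan in ht. replace (2 * (c * PI / 4)) with (c * PI / 2) in ht by field.
  (* The scale is forced by [f 1 0 = 1]. *)
  apply (pattern_asymptotics c (/ s 0%nat) phi (cos (c * PI / 2), sin (c * PI / 2)) f);
    [lra | now apply Rinv_0_lt_compat | exact hphi | apply Cmod_cos_sin |].
  assert (hla : / s 0%nat * s 0%nat = 1) by (field; lra).
  apply (pattern_edges c (/ s 0%nat) s q); auto.
  - lra.
  - now apply Rinv_0_lt_compat.
  - apply Cmod_cos_sin.
  - intros n m. apply hcr.
  - now apply constraint_constraint_mult.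
  - now rewrite hla.
  - rewrite hla, h01. symmetry. apply Cmult_1_l.
  - lra.
Qed.

Lemma Z2_asymptotics (f : nat -> nat -> C) :
  is_Z2 f ->
  exists K, 0 < K /\ forall N0 : Z,
    is_lim_seq (fun M : nat => radius f N0 M / (K * Rpower (INR M) (2 - 1))) 1.
Proof.
  intros (hcr & hco & h00 & h10 & h01 & h20 & h02 & h11). assert (hpi := PI_RGT_0).
  destruct (diag_solution_exists 2 ltac:(lra)) as [phi hphi].
  assert (hd := diag_solution_diagonal 2 phi hphi).
  set (s := diag_radius phi) in *. set (q := side_radius phi) in *.
  assert (hs1 : s 1%nat = 1) by reflexivity.
  assert (hs0 : s 0%nat = 0).
  { destruct hd as (_ & _ & _ & h & _). simpl INR in h. lra. }
  assert (hb := boundary_value 2 s q ltac:(lra) hd).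
  assert (hI0 := cos_moment_0 (2 / 2) ltac:(lra)).
  replace (2 / 2) with 1 in * by field. rewrite cos_moment_1_1, hs1 in hb. rewrite Rmult_1_l in hI0.
  rewrite Rmult_1_l, sin_PI2 in hI0. rewrite hI0 in hb.
  (* With [s 1 = 1], the single scale [2 / PI] then matches both [f 2 0 = 1] and [f 1 1 = 2i/PI]. *)
  assert (hq : q 1%nat = PI / 2) by lra.
  assert (hla : 2 / PI * q 1%nat = 1) by (rewrite hq; field; lra).
  assert (hla0 : 0 < 2 / PI) by (apply Rdiv_lt_0_compat; lra).
  apply (pattern_asymptotics 2 (2 / PI) phi (- (1))%C f); auto; [lra | now rewrite Cmod_opp, Cmod_1 |].
  apply (pattern_edges 2 (2 / PI) s q); auto.
  - lra.
  - now rewrite Cmod_opp, Cmod_1.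
  - rewrite hs0, hs1. unfold Copp, RtoC, Cmult; simpl. f_equal; ring.
  - now rewrite hs0, Rmult_0_r.
  - rewrite hs0, Rmult_0_r, h01. ring.
  - intros _. rewrite hla, hs1, h20, h02, h11. repeat split.
    + unfold Copp, RtoC, Cmult; simpl. f_equal; ring.
    + unfold Ci, RtoC, Cmult; simpl. f_equal; ring.
Qed.

Theorem theorem2 :
  (forall (c : R) (f : nat -> nat -> C), 0 < c < 2 -> is_Zc c f ->
     exists K : R, forall N0 : Z,
       is_lim_seq (fun M : nat => radius f N0 M / (K * Rpower (INR M) (c - 1))) 1)
  /\
  (forall f : nat -> nat -> C, is_Z2 f ->
     exists K : R, forall N0 : Z,
       is_lim_seq (fun M : nat => radius_Log f N0 M / (K * Rpower (INR M) (0 - 1))) 1).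
Proof.
  split.
  - intros c f hc hf. destruct (Zc_asymptotics c f hc hf) as (K & _ & h). exists K. exact h.
  - intros f hf. destruct (Z2_asymptotics f hf) as (K & hK & h). exists (/ K). intros N0.
    apply (is_lim_seq_ext (fun M => / (radius f N0 M / (K * Rpower (INR M) (2 - 1))))).
    + intros M. unfold radius_Log. replace (0 - 1) with (- (2 - 1)) by ring. rewrite Rpower_Ropp.
      unfold Rdiv. rewrite !Rinv_mult, !Rinv_inv. ring.
    + apply is_lim_seq_inv1, h.
Qed.
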